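(* There is an algorithm that, given an instance $(G,R,t,k)$ of Steiner Tree in which $G$ is an $n$-vertex unit disk graph, $R\subseteq V(G)$ is a set of $t$ terminals and $k$ is a positive integer, decides whether $(G,R,t,k)$ is a yes-instance in time $2^{O(k)}n^{O(1)}$.
   Context: Steiner Tree: the input $(G,R,t,k)$ consists of a graph $G$ on $n$ vertices (unweighted), a set $R\subseteq V(G)$ with $|R|=t$ whose elements are called terminals, and a positive integer $k$. The question is whether there is a tree $T$ that is a subgraph of $G$ with $R\subseteq V(T)$ and $|V(T)\setminus R|\le k$. Vertices of $V(T)\setminus R$ are called Steiner vertices. A unit disk graph is the intersection graph of finitely many unit disks in the plane: one vertex per disk, and two vertices are adjacent exactly when the corresponding disks intersect. *)

(* Defs.v *)
From mathcomp Require Import all_boot all_order all_algebra.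
From mathcomp Require Import reals.

Set Implicit Arguments.
Unset Strict Implicit.
Unset Printing Implicit Defensive.

Import Order.TTheory GRing.Theory Num.Theory.

(** ** Graphs, trees and the Steiner Tree problem *)

Definition simple_graph (V : finType) (G : rel V) : Prop :=
  symmetric G /\ irreflexive G.

(** A subgraph of [G] is given by a vertex set [W] and an edge relation [F],
    which need not be induced. *)
Definition subgraph (V : finType) (G : rel V) (W : {set V}) (F : rel V) : Prop :=
  simple_graph F /\ forall x y, F x y -> [/\ x \in W, y \in W & G x y].

(** In a symmetric relation every edge [x, y] is a [ucycle] of size 2, whence the
    restriction to at least three vertices. *)
Definition acyclic (V : finType) (F : rel V) : Prop :=
  forall s : seq V, 2 < size s -> ~ ucycle F s.

(** The graph without vertices is not a tree. *)
Definition tree (V : finType) (W : {set V}) (F : rel V) : Prop :=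
  [/\ W != set0, {in W &, forall x y, connect F x y} & acyclic F].

Definition steiner_yes (V : finType) (G : rel V) (R : {set V}) (k : nat) : Prop :=
  exists (W : {set V}) (F : rel V),
    [/\ subgraph G W F, tree W F, R \subset W & #|W :\: R| <= k].

(** ** Unit disk graphs *)

(** The closed disk of radius 1 centred at [c]. *)
Definition in_unit_disk (K : realType) (c p : K * K) : bool :=
  ((p.1 - c.1) ^+ 2 + (p.2 - c.2) ^+ 2 <= 1)%R.

(** [c x] is the centre of the disk of the vertex [x]; distinct vertices may have
    the same disk. *)
Definition unit_disk_graph (K : realType) (V : finType) (G : rel V) : Prop :=
  exists c : V -> K * K, forall x y : V, x != y ->
    (G x y <-> exists p : K * K, in_unit_disk (c x) p /\ in_unit_disk (c y) p).

(** ** Random access machines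

    The machine of Cook and Reckhow with unit costs: registers [X_0, X_1, ...]
    hold natural numbers, and the only arithmetic operations are addition and
    (truncated) subtraction. Without multiplication, [t] steps produce numbers of
    at most [t] bits more than the constants and inputs, so that unit-cost time is
    polynomially related to Turing machine time. *)

Inductive instr : Type :=
| Const of nat & nat         (* X_i <- a           *)
| Add of nat & nat & nat     (* X_i <- X_j + X_l   *)
| Sub of nat & nat & nat     (* X_i <- X_j - X_l   *)
| Fetch of nat & nat         (* X_i <- X_(X_j)     *)
| Write of nat & nat         (* X_(X_i) <- X_j     *)
| Jump of nat & nat.         (* if X_i > 0 goto l  *)

Definition program := seq instr.
Definition memory := nat -> nat.

(** The program counter and the registers. *)
Definition config := (nat * memory)%type.

Definition upd (m : memory) (i v : nat) : memory :=
  fun j => if j == i then v else m j.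

Definition exec (ins : instr) (pc : nat) (m : memory) : config :=
  match ins with
  | Const i a => (pc.+1, upd m i a)
  | Add i j l => (pc.+1, upd m i (m j + m l))
  | Sub i j l => (pc.+1, upd m i (m j - m l))
  | Fetch i j => (pc.+1, upd m i (m (m j)))
  | Write i j => (pc.+1, upd m (m i) (m j))
  | Jump i l => (if 0 < m i then l else pc.+1, m)
  end.

(** The machine halts when the program counter leaves the program; a halted
    configuration is a fixed point of [step]. *)
Definition halted (P : program) (c : config) : bool := size P <= c.1.

Definition step (P : program) (c : config) : config :=
  if onth P c.1 is Some ins then exec ins c.1 c.2 else c.

(** From the initial registers [m], the machine halts after at most [b] steps,
    and then [X_0 <> 0] (acceptance) if and only if [A] holds. *)
Definition decides_within (P : program) (m : memory) (b : nat) (A : Prop) : Prop :=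
  exists2 s, s <= b &
    let c := iter s (step P) (0, m) in
    halted P c /\ (c.2 0 != 0 <-> A).

(** The input registers: [n], [t], [k], the characteristic vector of [R], the
    adjacency matrix of [G] row by row, and then zeros. *)
Definition encode (n : nat) (G : rel 'I_n) (R : {set 'I_n}) (t k : nat) : memory :=
  nth 0 ([:: n; t; k]
           ++ [seq nat_of_bool (i \in R) | i <- enum 'I_n]
           ++ [seq nat_of_bool (G i j) | i <- enum 'I_n, j <- enum 'I_n]).

(* Main.v *)
(* In a unit disk graph at most nine pairwise non-adjacent vertices have a common
   neighbour: the centres of such neighbours lie in a square of side 4, and two of
   them in the same cell of a 3 x 3 grid on that square would be adjacent. Hence,
   if G[R] has m > 1 components and the terminals are joined by k Steiner vertices,
   every component is adjacent to a Steiner vertex and m <= 9 k; instances with more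
   components are rejected. Otherwise there are at most 2 ^ (9 k) unions of
   components, and a dynamic program in the style of Dreyfus and Wagner computes,
   for every such union S and every vertex v, the least number of Steiner vertices
   in a connected set that contains v and S: two such sets, for (S1, u) and (S2, v)
   with u and v adjacent, are joined into one for (S, u) whenever S is contained in
   the union of S1 and S2. Connected sets decompose in this way, so that n rounds
   of joins suffice.

   The algorithm is written in a loop language whose loop bounds are read-only
   variables; the running time of a compiled program is then bounded by a polynomial
   in the values of these variables. *)
Require Import Defs.
From mathcomp Require Import all_boot all_order all_algebra.
From mathcomp Require Import reals.
From mathcomp Require Import zify ring lra.

Set Implicit Arguments.
Unset Strict Implicit.
Unset Printing Implicit Defensive.

(** ** A loop language and its compilation *)

(** Loop bounds are read-only, yet [2 ^ (9 * k)] and the length of the input have to be computed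
    before they can bound loops. Hence one block computes them, and a second block, compiled
    separately, treats them as read-only.

    Unions of components are never encoded as subsets of an index set. They are rows of a table that
    is built by doubling, and inclusion tests between rows replace all arithmetic on subsets; the
    join step simply runs over all triples of rows.

    A subtree of a Steiner tree may cut through a component of G[R], so its terminals need not form
    a union of components. It is therefore credited with every component that it meets. This costs
    nothing, because terminals are free, and it makes the recursion over subtrees compatible with
    the table. *)

(* Registers below [nv] hold the variables of the loop language, those from [nv] to
   [nr - 1] are temporaries, and cell [a] of array [t < 4] is register
   [nr + 4 * a + t]. *)
Definition nv := 16.
Definition nr := 32.

(** [ESum i r a] sums [a] over [i] below the value of [r]. It replaces multiplication, which the
    machine lacks, and, as a count, the bounded quantifier of inclusion tests. *)
Inductive exp : Type :=
| EV of nat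
| EK of nat
| EAdd of exp & exp
| ESub of exp & exp
| ELd of nat & exp
| ESum of nat & nat & exp.

Inductive cmd : Type :=
| CAsn of nat & exp
| CSt of nat & exp & exp
| CSeq of cmd & cmd
| CIf of exp & cmd
| CFor of nat & nat & cmd.

Record state := State { env : nat -> nat; arr : nat -> nat -> nat }.

Definition setv (s : state) i x := State (upd (env s) i x) (arr s).
Definition seta (s : state) t a x :=
  State (env s) (fun t' => if t' == t then upd (arr s t) a x else arr s t').

Fixpoint ev (e : exp) (s : state) : nat :=
  match e with
  | EV i => env s i
  | EK a => a
  | EAdd a b => ev a s + ev b s
  | ESub a b => ev a s - ev b s
  | ELd t a => arr s t (ev a s)
  | ESum i r a => \sum_(j < env s r) ev a (setv s i j)
  end.

(** The bound of a loop is read once, whereas the compiled code rereads it at every test; [wfc]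
    makes the two agree. The counter ends equal to the bound, as in the compiled code. *)
Fixpoint eval (c : cmd) (s : state) : state :=
  match c with
  | CAsn i e => setv s i (ev e s)
  | CSt t e1 e2 => seta s t (ev e1 s) (ev e2 s)
  | CSeq c1 c2 => eval c2 (eval c1 s)
  | CIf e c1 => if ev e s != 0 then eval c1 s else s
  | CFor i r c1 =>
      setv (foldl (fun s' j => eval c1 (setv s' i j)) s (iota 0 (env s r)))
           i (env s r)
  end.

Fixpoint modv (c : cmd) : seq nat :=
  match c with
  | CAsn i _ => [:: i]
  | CSt _ _ _ => [::]
  | CSeq c1 c2 => modv c1 ++ modv c2
  | CIf _ c1 => modv c1
  | CFor i _ c1 => i :: modv c1
  end.

Fixpoint moda (c : cmd) : seq nat :=
  match c with
  | CAsn _ _ => [::]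
  | CSt t _ _ => [:: t]
  | CSeq c1 c2 => moda c1 ++ moda c2
  | CIf _ c1 => moda c1
  | CFor _ _ c1 => moda c1
  end.

Lemma eval_modv c s x : x \notin modv c -> env (eval c s) x = env s x.
Proof.
elim: c s => [i e|t e1 e2|c1 IH1 c2 IH2|e c IH|i r c IH] s //=.
- by rewrite inE /upd => /negbTE ->.
- by rewrite mem_cat negb_or => /andP[h1 h2]; rewrite IH2 // IH1.
- by move=> h; case: ifP => // _; apply: IH.
- rewrite inE negb_or => /andP[/negbTE h1 h2]; rewrite /upd h1.
  move: (iota _ _) => l; elim: l s => [|j l IHl] s //=.
  by rewrite IHl IH //= /upd h1.
Qed.

Lemma eval_moda c s t : t \notin moda c -> arr (eval c s) t = arr s t.
Proof.
elim: c s => [i e|u e1 e2|c1 IH1 c2 IH2|e c IH|i r c IH] s //=.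
- by rewrite inE => /negbTE ->.
- by rewrite mem_cat negb_or => /andP[h1 h2]; rewrite IH2 // IH1.
- by move=> h; case: ifP => // _; apply: IH.
- move=> h; move: (iota _ _) => l; elim: l s => [|j l IHl] s //=.
  by rewrite IHl IH.
Qed.

Fixpoint esize (e : exp) : nat :=
  match e with
  | EV _ => 2
  | EK _ => 1
  | EAdd a b | ESub a b => esize a + esize b + 1
  | ELd _ a => esize a + 5
  | ESum _ _ a => esize a + 13
  end.

(** The value ends in register [d], and the registers from [d] on are scratch. Copying is addition
    of zero, an unconditional jump tests a fresh 1, and the address [nr + 4 * a + t] comes from two
    doublings. A sum saves its counter variable in [d.+1] and restores it at the end. *)
Fixpoint ecomp (e : exp) (d pc : nat) : seq instr :=
  match e with
  | EV i => [:: Const d 0; Add d i d]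
  | EK a => [:: Const d a]
  | EAdd a b => ecomp a d pc ++ ecomp b d.+1 (pc + esize a) ++ [:: Add d d d.+1]
  | ESub a b => ecomp a d pc ++ ecomp b d.+1 (pc + esize a) ++ [:: Defs.Sub d d d.+1]
  | ELd t a =>
      ecomp a d pc ++ [:: Add d d d; Add d d d; Const d.+1 (nr + t);
                          Add d d d.+1; Fetch d d]
  | ESum i r a =>
      [:: Const d 0; Add d.+1 i d; Const i 0;
          Defs.Sub d.+2 r i; Jump d.+2 (pc + 7); Const d.+2 1;
          Jump d.+2 (pc + 7 + esize a + 4)]
      ++ ecomp a d.+2 (pc + 7)
      ++ [:: Add d d d.+2; Const d.+2 1; Add i i d.+2; Jump d.+2 (pc + 3);
             Const d.+2 0; Add i d.+1 d.+2]
  end.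

Fixpoint csize (c : cmd) : nat :=
  match c with
  | CAsn _ e => esize e + 2
  | CSt _ e1 e2 => esize e1 + esize e2 + 5
  | CSeq c1 c2 => csize c1 + csize c2
  | CIf e c1 => esize e + 3 + csize c1
  | CFor _ _ c1 => csize c1 + 8
  end.

Fixpoint ccomp (c : cmd) (pc : nat) : seq instr :=
  match c with
  | CAsn i e => ecomp e nv pc ++ [:: Const nv.+1 0; Add i nv nv.+1]
  | CSt t e1 e2 =>
      ecomp e1 nv pc ++ ecomp e2 nv.+1 (pc + esize e1)
      ++ [:: Add nv nv nv; Add nv nv nv; Const nv.+2 (nr + t);
             Add nv nv nv.+2; Write nv nv.+1]
  | CSeq c1 c2 => ccomp c1 pc ++ ccomp c2 (pc + csize c1)
  | CIf e c1 =>
      ecomp e nv pc ++ [:: Jump nv (pc + esize e + 3); Const nv 1;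
                           Jump nv (pc + esize e + 3 + csize c1)]
      ++ ccomp c1 (pc + esize e + 3)
  | CFor i r c1 =>
      [:: Const i 0; Defs.Sub nv r i; Jump nv (pc + 5); Const nv 1;
          Jump nv (pc + 5 + csize c1 + 3)]
      ++ ccomp c1 (pc + 5)
      ++ [:: Const nv 1; Add i i nv; Jump nv (pc + 1)]
  end.

Lemma size_ecomp e d pc : size (ecomp e d pc) = esize e.
Proof.
elim: e d pc => [i|a|a IHa b IHb|a IHa b IHb|t a IH|i r a IH] d pc //=;
  rewrite ?size_cat /= ?IHa ?IHb ?IH //=; lia.
Qed.

Lemma size_ccomp c pc : size (ccomp c pc) = csize c.
Proof.
elim: c pc => [i e|t e1 e2|c1 IH1 c2 IH2|e c IH|i r c IH] pc /=;
  rewrite ?size_cat /= ?size_ecomp ?IH1 ?IH2 ?size_cat ?IH //=; lia.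
Qed.

(* [B] is the set of the variables that may bound a loop. No loop bound is ever
   assigned to, which makes the running time a function of the syntax alone. *)
Fixpoint wfe (B : pred nat) (e : exp) (d : nat) : bool :=
  match e with
  | EV i => (i < nv) && (d < nr)
  | EK _ => d < nr
  | EAdd a b | ESub a b => wfe B a d && wfe B b d.+1
  | ELd t a => [&& t < 4, wfe B a d & d.+1 < nr]
  | ESum i r a => [&& i < nv, r < nv, B r, ~~ B i, d.+2 < nr & wfe B a d.+2]
  end.

Fixpoint wfc (B : pred nat) (c : cmd) : bool :=
  match c with
  | CAsn i e => [&& i < nv, ~~ B i & wfe B e nv]
  | CSt t e1 e2 => [&& t < 4, wfe B e1 nv & wfe B e2 nv.+1]
  | CSeq c1 c2 => wfc B c1 && wfc B c2
  | CIf e c1 => wfe B e nv && wfc B c1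
  | CFor i r c1 =>
      [&& i < nv, r < nv, B r, ~~ B i, i \notin modv c1 & wfc B c1]
  end.

(** * Polynomial bounds on the running time *)

Fixpoint etime (e : exp) (M : nat) : nat :=
  match e with
  | EV _ => 2
  | EK _ => 1
  | EAdd a b | ESub a b => etime a M + etime b M + 1
  | ELd _ a => etime a M + 5
  | ESum _ _ a => 9 + M * (etime a M + 6)
  end.

Fixpoint ctime (c : cmd) (M : nat) : nat :=
  match c with
  | CAsn _ e => etime e M + 2
  | CSt _ e1 e2 => etime e1 M + etime e2 M + 5
  | CSeq c1 c2 => ctime c1 M + ctime c2 M
  | CIf e c1 => etime e M + 3 + ctime c1 M
  | CFor _ _ c1 => 5 + M * (ctime c1 M + 5)
  end.

Definition poly_bounded (f : nat -> nat) :=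
  exists A D, forall M, f M <= A * M.+1 ^ D.

Lemma poly_bounded_const a : poly_bounded (fun _ => a).
Proof. by exists a, 0 => M; rewrite muln1. Qed.

Lemma poly_bounded_id : poly_bounded id.
Proof. by exists 1, 1 => M; rewrite mul1n expn1. Qed.

Lemma poly_bounded_add f g :
  poly_bounded f -> poly_bounded g -> poly_bounded (fun M => f M + g M).
Proof.
move=> [A [D hf]] [A' [D' hg]]; exists (A + A'), (D + D') => M.
rewrite mulnDl; apply: leq_add.
- by apply: leq_trans (hf M) _; rewrite leq_mul2l leq_pexp2l ?orbT ?leq_addr.
- by apply: leq_trans (hg M) _; rewrite leq_mul2l leq_pexp2l ?orbT ?leq_addl.
Qed.

Lemma poly_bounded_mul f g :
  poly_bounded f -> poly_bounded g -> poly_bounded (fun M => f M * g M).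
Proof.
move=> [A [D hf]] [A' [D' hg]]; exists (A * A'), (D + D') => M.
by rewrite expnD mulnACA leq_mul.
Qed.

Lemma poly_bounded_etime e : poly_bounded (etime e).
Proof.
elim: e => [i|a|a IHa b IHb|a IHa b IHb|t a IH|i r a IH] /=;
  repeat (first [exact: poly_bounded_const | exact: poly_bounded_id |
    assumption | apply: poly_bounded_add | apply: poly_bounded_mul]).
Qed.

Lemma poly_bounded_ctime c : poly_bounded (ctime c).
Proof.
elim: c => [i e|t e1 e2|c1 IH1 c2 IH2|e c IH|i r c IH] /=;
  repeat (first [exact: poly_bounded_const | exact: poly_bounded_id |
    exact: poly_bounded_etime |
    assumption | apply: poly_bounded_add | apply: poly_bounded_mul]).
Qed.

(** * Correctness of the compilation *)

Definition code_at (P : program) pc (code : seq instr) :=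
  forall i, i < size code -> onth P (pc + i) = onth code i.

Lemma code_at_cat P pc a b :
  code_at P pc (a ++ b) -> code_at P pc a /\ code_at P (pc + size a) b.
Proof.
move=> h; split=> i hi.
- by rewrite h ?size_cat ?ltn_addr // onth_cat hi.
- by rewrite -addnA h ?size_cat ?ltn_add2l // onth_cat ltnNge leq_addr addKn.
Qed.

Lemma code_at_cons P pc x a :
  code_at P pc (x :: a) -> onth P pc = Some x /\ code_at P pc.+1 a.
Proof.
move=> h; split; first by have := h 0 isT; rewrite addn0.
by move=> i hi; rewrite addSnnS h.
Qed.

Definition reach (P : program) T (c c' : config) :=
  exists2 t, t <= T & iter t (step P) c = c'.

Lemma reach_refl P T c : reach P T c c.
Proof. by exists 0. Qed.

Lemma reach_trans P T1 T2 c1 c2 c3 :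
  reach P T1 c1 c2 -> reach P T2 c2 c3 -> reach P (T1 + T2) c1 c3.
Proof.
move=> [t1 h1 e1] [t2 h2 e2]; exists (t2 + t1); first by rewrite addnC leq_add.
by rewrite iterD e1.
Qed.

Lemma reach_le P T T' c c' : T <= T' -> reach P T c c' -> reach P T' c c'.
Proof. by move=> h [t h1 h2]; exists t => //; apply: leq_trans h. Qed.

Lemma reach_step P T pc m ins c :
  onth P pc = Some ins -> reach P T (exec ins pc m) c -> reach P T.+1 (pc, m) c.
Proof.
move=> h [t h1 h2]; exists t.+1 => //.
by rewrite iterSr /step /= h.
Qed.

Definition agree (s : state) (m : memory) :=
  (forall i, i < nv -> m i = env s i) /\
  (forall t a, t < 4 -> m (nr + 4 * a + t) = arr s t a).

Lemma agree_setv s m i x m' :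
  i < nv -> agree s m -> m' i = x ->
  (forall y, y < nv -> y != i -> m' y = m y) ->
  (forall y, nr <= y -> m' y = m y) -> agree (setv s i x) m'.
Proof.
move=> hi [h1 h2] e h h'; split=> [y hy|t a ht] /=.
- rewrite /upd; case: eqP => [->//|/eqP ne]; by rewrite h ?h1.
- by rewrite h' ?h2 //; lia.
Qed.

Lemma agree_same s m m' :
  agree s m -> (forall y, y < nv -> m' y = m y) ->
  (forall y, nr <= y -> m' y = m y) -> agree s m'.
Proof.
move=> [h1 h2] h h'; split=> [y hy|t a ht]; first by rewrite h ?h1.
by rewrite h' ?h2 //; lia.
Qed.

Lemma wfc_bound B c r : wfc B c -> B r -> r \notin modv c.
Proof.
move=> + Br.
elim: c => [i e|t e1 e2|c1 IH1 c2 IH2|e c IH|i q c IH] //=.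
- by case/and3P=> _ Bi _; rewrite inE; apply: contraNneq Bi => <-.
- by case/andP=> w1 w2; rewrite mem_cat negb_or IH1 ?IH2.
- by case/andP=> _ /IH.
- case/and5P=> _ _ _ Bi /andP[_ /IH h]; rewrite inE negb_or h andbT.
  by apply: contraNneq Bi => <-.
Qed.

Lemma updE m i v : upd m i v i = v.
Proof. by rewrite /upd eqxx. Qed.

Lemma upd_neq m i v j : j != i -> upd m i v j = m j.
Proof. by rewrite /upd => /negbTE ->. Qed.

Ltac updl := rewrite ?(updE, upd_neq) //; try (unfold nr, nv in *; lia).
Ltac run h := eapply reach_step; [apply: h | rewrite /=].

Definition bounded (B : pred nat) M s := forall r, B r -> env s r <= M.

Lemma bounded_setv B M s i x : ~~ B i -> bounded B M s -> bounded B M (setv s i x).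
Proof. by move=> hi h r hr; rewrite /= /upd; case: eqP hi => [<-|_ _]; [rewrite hr | apply: h]. Qed.

(** The registers below [d] include all variables and the pending operands; since they are
    preserved, a second operand can be evaluated one register higher. *)
Definition ecomp_spec P B M e := forall d pc s m,
  wfe B e d -> nv <= d -> code_at P pc (ecomp e d pc) -> agree s m ->
  bounded B M s ->
  exists m', [/\ reach P (etime e M) (pc, m) (pc + esize e, m'), m' d = ev e s,
    forall x, x < d -> m' x = m x & forall x, nr <= x -> m' x = m x].

Lemma wfe_ltn B e d : wfe B e d -> d < nr.
Proof.
elim: e d => [i|a|a IHa b IHb|a IHa b IHb|t a IH|i r a IH] d //=.
- by case/andP.
- by case/andP => /IHa.
- by case/andP => /IHa.
- by case/and3P=> _ /IH.
- by case/and5P=> _ _ _ _ /andP[h _]; apply: ltn_trans h; apply: leqnSn.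
Qed.

Lemma ecomp_sum P B M i r a :
  ecomp_spec P B M a -> ecomp_spec P B M (ESum i r a).
Proof.
move=> IH d pc s m /and5P[hi hr Br Bi /andP[hd wa]] nvd.
rewrite /= => /code_at_cons[i0 /code_at_cons[i1 /code_at_cons[i2 /code_at_cons[i3
  /code_at_cons[i4 /code_at_cons[i5 /code_at_cons[i6 /code_at_cat[ca]]]]]]]].
rewrite size_ecomp => /code_at_cons[i7 /code_at_cons[i8 /code_at_cons[i9
  /code_at_cons[i10 /code_at_cons[i11 /code_at_cons[i12 _]]]]]].
move=> ag bd.
have ir : r != i by apply: contraNneq Bi => <-.
(* Induction on the number [q] of remaining iterations: register [d] holds the partial sum, and the
   memory agrees with the state whose counter is [j]. The last 4 steps are the failing test and the
   exit. *)
have loop q j m1 : j + q = env s r -> agree (setv s i j) m1 ->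
    m1 d = \sum_(l < j) ev a (setv s i l) ->
    exists m2, [/\ reach P (q * (etime a M + 6) + 4) (pc.+3, m1) (pc + esize a + 11, m2),
      m2 d = \sum_(l < env s r) ev a (setv s i l), m2 d.+1 = m1 d.+1,
      forall x, x < d -> x != i -> m2 x = m1 x & forall x, nr <= x -> m2 x = m1 x].
  elim: q j m1 => [|q IHq] j m1 hj ag1 hsum.
    have ej : j = env s r by lia.
    eexists; split.
    - run i3; run i4; rewrite updE ag1.1 // ag1.1 //= updE upd_neq // ej subnn /=.
      run i5; run i6; rewrite updE /=.
      have -> : pc + 7 + esize a + 4 = pc + esize a + 11 by lia.
      exact: reach_refl.
    - by updl; rewrite hsum ej.
    - by updl.
    - by move=> x xd xi; updl.
    - by move=> x xn; updl.
  have hjr : 0 < m1 r - m1 i by rewrite !ag1.1 //= updE upd_neq //; lia.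
  pose m2 := upd m1 d.+2 (m1 r - m1 i).
  have ag2 : agree (setv s i j) m2.
    by apply: agree_same ag1 _ _ => y hy; rewrite /m2; updl.
  have [|||m3 [r3 v3 f3 g3]] := IH d.+2 (pc + 7) (setv s i j) m2 wa _ _ ag2.
  - lia.
  - by move: ca; rewrite (_ : pc.+4.+3 = pc + 7) //; lia.
  - exact: bounded_setv.
  pose m4 := upd (upd (upd m3 d (m3 d + m3 d.+2)) d.+2 1) i (m3 i + 1).
  have m3i : m3 i = j.
    by rewrite f3 ?ag2.1 //= ?updE //; lia.
  have ag4 : agree (setv s i j.+1) m4.
    have ag3 : agree (setv s i j) m3.
      by apply: agree_same ag2 _ _ => y hy; [rewrite f3 //; lia|rewrite g3].
    split=> [y hy|t b ht] /=.
      rewrite /m4 /upd; case: (eqVneq y i) => [_|yi]; first by rewrite m3i addn1.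
      by do 2 (case: eqP => [?|_]; first lia); rewrite ag3.1 //= upd_neq.
    by rewrite /m4; updl; rewrite ag3.2.
  have [|||m5 [r5 s5 k5 f5 g5]] := IHq j.+1 m4.
  - lia.
  - exact: ag4.
  - rewrite /m4 big_ord_recr /= -hsum v3; updl; rewrite f3 ?/m2; updl.
  exists m5; split.
  - have -> : q.+1 * (etime a M + 6) + 4 =
       (etime a M + (q * (etime a M + 6) + 4).+4).+2 by lia.
    run i3; run i4; rewrite updE hjr /=.
    apply: reach_trans r3 _.
    have -> : pc + 7 + esize a = pc.+4.+3 + esize a by lia.
    run i7; run i8; run i9; run i10; rewrite !updE /= upd_neq ?updE; last lia.
    have -> : pc + 3 = pc.+3 by lia.
    by rewrite !upd_neq //; lia.
  - exact: s5.
  - by rewrite k5 /m4; updl; rewrite f3 ?/m2; updl.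
  - by move=> x xd xi; rewrite f5 // /m4; updl; rewrite f3 ?/m2; updl.
  - by move=> x xn; rewrite g5 // /m4; updl; rewrite g3 ?/m2; updl.
pose m1 := upd (upd (upd m d 0) d.+1 (m i)) i 0.
have [|||m2 [r2 v2 k2 f2 g2]] := loop (env s r) 0 m1.
- by [].
- apply: (@agree_setv s m) => //; rewrite /m1; first by rewrite updE.
    by move=> y hy yi; updl.
  by move=> y hy; updl.
- by rewrite big_ord0 /m1; updl.
have Nm := bd r Br.
eexists; split.
- have -> : 9 + M * (etime a M + 6) =
     (M * (etime a M + 6) + 4 + 2).+3 by lia.
  run i0; run i1; run i2; rewrite updE.
  apply: reach_trans.
    have -> : upd m d 0 i + 0 = m i by updl.
    apply: reach_le r2.
    by rewrite leq_add2r leq_mul2r Nm orbT.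
  have -> : pc + esize a + 11 = pc.+4.+3 + esize a + 4 by lia.
  rewrite !addnS addn0.
  run i11; run i12.
  have -> : (pc.+4.+3 + esize a).+4.+2 = (pc + esize a).+4.+4.+4.+1 by lia.
  rewrite addn0; exact: reach_refl.
- by updl; rewrite v2.
- move=> x xd; case: (eqVneq x i) => [->|xi].
    by rewrite !updE upd_neq ?k2 /m1; updl; rewrite updE; updl.
  by updl; rewrite f2 // /m1; updl.
- by move=> x xn; updl; rewrite g2 // /m1; updl.
Qed.

Lemma ecomp_correct P B M e : ecomp_spec P B M e.
Proof.
elim: e => [i|a|a IHa b IHb|a IHa b IHb|t a IH|i r a IH]; last exact: ecomp_sum.
- move=> d pc s m /andP[hi hd] nvd /code_at_cons[i0 /code_at_cons[i1 _]] ag bd.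
  eexists; split.
  + by run i0; run i1; rewrite addn2; apply: reach_refl.
  + by rewrite !updE addn0; updl; rewrite ag.1.
  + by move=> x hx; updl.
  + by move=> x hx; updl.
- move=> d pc s m hd nvd /code_at_cons[i0 _] ag bd.
  eexists; split.
  + by run i0; rewrite addn1; apply: reach_refl.
  + by rewrite !updE.
  + by move=> x hx; updl.
  + by move=> x hx; rewrite /= in hd; updl.
all: move=> d pc s m.
- move=> /andP[wa wb] nvd /= /code_at_cat[ca] /code_at_cat[].
  rewrite !size_ecomp => cb /code_at_cons[i0 _] ag bd.
  have [m1 [r1 v1 f1 g1]] := IHa d pc s m wa nvd ca ag bd.
  have ag1 : agree s m1.
    by apply: agree_same ag _ _ => y hy; [rewrite f1 //; lia|rewrite g1].
  have [m2 [r2 v2 f2 g2]] := IHb d.+1 _ s m1 wb (leqW nvd) cb ag1 bd.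
  have dn := wfe_ltn wa.
  eexists; split.
  + rewrite -addnA; apply: reach_trans r1 _; apply: reach_trans r2 _.
    by run i0; rewrite !addnA addn1; apply: reach_refl.
  + by rewrite updE v2 f2 // v1.
  + by move=> x hx; updl; rewrite f2 ?f1 //; lia.
  + by move=> x hx; updl; rewrite g2 ?g1 //; lia.
- move=> /andP[wa wb] nvd /= /code_at_cat[ca] /code_at_cat[].
  rewrite !size_ecomp => cb /code_at_cons[i0 _] ag bd.
  have [m1 [r1 v1 f1 g1]] := IHa d pc s m wa nvd ca ag bd.
  have ag1 : agree s m1.
    by apply: agree_same ag _ _ => y hy; [rewrite f1 //; lia|rewrite g1].
  have [m2 [r2 v2 f2 g2]] := IHb d.+1 _ s m1 wb (leqW nvd) cb ag1 bd.
  have dn := wfe_ltn wa.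
  eexists; split.
  + rewrite -addnA; apply: reach_trans r1 _; apply: reach_trans r2 _.
    by run i0; rewrite !addnA addn1; apply: reach_refl.
  + by rewrite updE v2 f2 // v1.
  + by move=> x hx; updl; rewrite f2 ?f1 //; lia.
  + by move=> x hx; updl; rewrite g2 ?g1 //; lia.
- move=> /and3P[ht wa hd] nvd /= /code_at_cat[ca].
  rewrite size_ecomp => /code_at_cons[i0 /code_at_cons[i1 /code_at_cons[i2
    /code_at_cons[i3 /code_at_cons[i4 _]]]]] ag bd.
  have [m1 [r1 v1 f1 g1]] := IH d pc s m wa nvd ca ag bd.
  have ag1 : agree s m1.
    by apply: agree_same ag _ _ => y hy; [rewrite f1 //; lia|rewrite g1].
  eexists; split.
  + apply: reach_trans r1 _; run i0; run i1; run i2; run i3; run i4.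
    by rewrite addnA !addnS addn0; apply: reach_refl.
  + rewrite !updE; set A := upd _ _ _ d.
    have -> : A = 4 * m1 d by rewrite /A; updl; lia.
    rewrite -v1 -ag1.2 //; updl; congr m1; lia.
  + by move=> x hx; updl; rewrite f1.
  + by move=> x hx; updl; rewrite g1.
Qed.

(** No variable in [B] is ever assigned, so the values of the loop bounds, and with them the bound
    [M], survive every command; each loop makes at most [M] rounds. *)
Lemma ccomp_correct P B M c pc s m :
  wfc B c -> code_at P pc (ccomp c pc) -> agree s m -> bounded B M s ->
  exists m', [/\ reach P (ctime c M) (pc, m) (pc + csize c, m'), agree (eval c s) m'
    & bounded B M (eval c s)].
Proof.
elim: c pc s m => [i e|t e1 e2|c1 IH1 c2 IH2|e c IH|i r c IH] pc s m /=.
- case/and3P=> hi Bi we /code_at_cat[ce]; rewrite size_ecomp.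
  move=> /code_at_cons[i0 /code_at_cons[i1 _]] ag bd.
  have [m1 [r1 v1 f1 g1]] := ecomp_correct we (leqnn _) ce ag bd.
  eexists; split; last exact: bounded_setv.
  + apply: reach_trans r1 _; run i0; run i1.
    by rewrite addnA !addnS addn0; apply: reach_refl.
  + apply: (agree_setv hi ag).
    * by rewrite updE; updl; rewrite v1 addn0.
    * by move=> y hy yi; updl; rewrite f1.
    * by move=> y hy; updl; rewrite g1.
- case/and3P=> ht w1 w2 /code_at_cat[ce1 /code_at_cat[]]; rewrite !size_ecomp => ce2.
  move=> /code_at_cons[i0 /code_at_cons[i1 /code_at_cons[i2
    /code_at_cons[i3 /code_at_cons[i4 _]]]]] ag bd.
  have [m1 [r1 v1 f1 g1]] := ecomp_correct w1 (leqnn _) ce1 ag bd.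
  have ag1 : agree s m1.
    by apply: agree_same ag _ _ => y hy; [rewrite f1|rewrite g1].
  have [m2 [r2 v2 f2 g2]] := ecomp_correct w2 (leqnSn _) ce2 ag1 bd.
  have ag2 : agree s m2.
    by apply: agree_same ag1 _ _ => y hy; [rewrite f2 // ltnW|rewrite g2].
  eexists; split; last by [].
  + rewrite -addnA; apply: reach_trans r1 _; apply: reach_trans r2 _.
    run i0; run i1; run i2; run i3; run i4.
    have -> : pc + (esize e1 + esize e2 + 5) = (pc + esize e1 + esize e2).+1.+4 by lia.
    exact: reach_refl.
  + set m3 := upd _ nv.+2 _; set A := upd m3 _ _ nv.
    have eA : A = nr + 4 * ev e1 s + t.
      rewrite /A updE /m3; updl; rewrite f2 ?v1 //; lia.
    have -> : upd m3 nv (m3 nv + m3 nv.+2) nv.+1 = ev e2 s.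
      by rewrite /m3; updl; rewrite v2.
    rewrite eA; split=> [y hy|u a hu] /=.
      by rewrite /m3; updl; rewrite ag2.1.
    (* A register number determines the array and the cell, since array numbers are below 4. *)
    rewrite {1}/upd; case: eqP => e0.
      have [-> ->] : u = t /\ a = ev e1 s by lia.
      by rewrite eqxx updE.
    rewrite /m3; updl; rewrite ag2.2 //; case: eqP => // et; rewrite upd_neq ?et //.
    by apply/eqP => ea; apply: e0; rewrite et ea.
- case/andP=> w1 w2 /code_at_cat[ce1]; rewrite size_ccomp => ce2 ag bd.
  have [m1 [r1 ag1 bd1]] := IH1 _ _ _ w1 ce1 ag bd.
  have [m2 [r2 ag2 bd2]] := IH2 _ _ _ w2 ce2 ag1 bd1.
  by exists m2; split=> //; apply: reach_trans r1 _; rewrite addnA.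
- case/andP=> we wc /code_at_cat[ce]; rewrite size_ecomp.
  move=> /code_at_cons[i0 /code_at_cons[i1 /code_at_cons[i2 cc]]] ag bd.
  have [m1 [r1 v1 f1 g1]] := ecomp_correct we (leqnn _) ce ag bd.
  have ag1 : agree s m1.
    by apply: agree_same ag _ _ => y hy; [rewrite f1|rewrite g1].
  case: ifP => [h|/eqP h].
    have e3 : pc + esize e + 3 = (pc + esize e).+3 by rewrite addn3.
    have [|m2 [r2 ag2 bd2]] := IH (pc + esize e + 3) s m1 wc _ ag1 bd.
      by rewrite {1}e3.
    exists m2; split=> //; rewrite -addnA; apply: reach_trans r1 _.
    apply: (@reach_le _ (ctime c M).+1); first lia.
    run i0; rewrite v1 lt0n h.
    by rewrite !addnA.
  eexists; split; last by [].
  + rewrite -addnA; apply: reach_trans r1 _.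
    apply: (@reach_le _ 3); first lia.
    run i0; rewrite v1 h /=; run i1; run i2; rewrite ?updE /=.
    by rewrite !addnA; apply: reach_refl.
  + by apply: agree_same ag1 _ _ => y hy; updl.
- case/and5P=> hi hr Br Bi /andP[nm wc].
  move=> /code_at_cons[i0 /code_at_cons[i1 /code_at_cons[i2
    /code_at_cons[i3 /code_at_cons[i4 /code_at_cat[cc]]]]]].
  rewrite size_ccomp => /code_at_cons[i5 /code_at_cons[i6 /code_at_cons[i7 _]]] ag bd.
  have ir : r != i by apply: contraNneq Bi => <-.
  set N := env s r.
  have loop q j s1 m1 : j + q = N -> env s1 r = N -> agree (setv s1 i j) m1 ->
      bounded B M s1 ->
      exists m2, [/\ reach P (q * (ctime c M + 5) + 4) (pc.+1, m1) (pc + (csize c + 8), m2),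
        agree (setv (foldl (fun s' l => eval c (setv s' i l)) s1 (iota j q)) i N) m2
        & bounded B M (setv (foldl (fun s' l => eval c (setv s' i l)) s1 (iota j q)) i N)].
    elim: q j s1 m1 => [|q IHq] j s1 m1 hj hN ag1 bd1.
      have ej : j = N by lia.
      eexists; split; last exact: bounded_setv.
      - run i1; run i2; rewrite ?updE !ag1.1 //= updE upd_neq // hN ej subnn /=.
        run i3; run i4; rewrite ?updE /=.
        have -> : pc + 5 + csize c + 3 = pc + (csize c + 8) by lia.
        exact: reach_refl.
      - rewrite /= -ej; apply: agree_same ag1 _ _ => y hy; updl.
    have hjr : 0 < m1 r - m1 i by rewrite !ag1.1 //= updE upd_neq // hN; lia.
    pose m2 := upd m1 nv (m1 r - m1 i).
    have ag2 : agree (setv s1 i j) m2.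
      by apply: agree_same ag1 _ _ => y hy; rewrite /m2; updl.
    have [||m3 [r3 ag3 bd3]] := IH (pc + 5) (setv s1 i j) m2 wc _ ag2.
    - by move: cc; rewrite (_ : pc.+1.+4 = pc + 5) //; lia.
    - exact: bounded_setv.
    set s3 := eval c _ in ag3 bd3.
    pose m4 := upd (upd m3 nv 1) i (m3 i + 1).
    have m3i : m3 i = j by rewrite ag3.1 // eval_modv //= updE.
    have ag4 : agree (setv s3 i j.+1) m4.
      apply: (agree_setv hi ag3); rewrite /m4.
      - by rewrite ?updE m3i addn1.
      - by move=> y hy yi; updl.
      - by move=> y hy; updl.
    have [||m5 [r5 ag5 bd5]] := IHq j.+1 s3 m4 _ _ ag4 bd3.
    - lia.
    - by rewrite eval_modv ?(wfc_bound wc) //= upd_neq.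
    exists m5; split=> //.
    have -> : q.+1 * (ctime c M + 5) + 4 =
       (ctime c M + (q * (ctime c M + 5) + 4).+3).+2 by lia.
    run i1; run i2; rewrite ?updE hjr /=.
    apply: reach_trans r3 _.
    have -> : pc + 5 + csize c = pc.+1.+4 + csize c by lia.
    run i5; run i6; run i7; rewrite upd_neq ?updE //=; last by unfold nv in *; lia.
    rewrite upd_neq; last by unfold nv in *; lia.
    by rewrite addn1.
  have [||||m2 [r2 ag2 bd2]] := loop N 0 s (upd m i 0).
  + by [].
  + by [].
  + apply: (agree_setv hi ag); first by rewrite updE.
      by move=> y hy yi; updl.
    by move=> y hy; updl.
  + exact: bd.
  exists m2; split=> //.
  have Nm : N <= M := bd r Br.
  have -> : 5 + M * (ctime c M + 5) = (M * (ctime c M + 5) + 4).+1 by lia.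
  run i0; apply: reach_le r2.
  by rewrite leq_add2r leq_mul2r Nm orbT.
Qed.

(** ** Connected sets and unions of components *)

Section Graph.
Variables (V : finType) (G : rel V).
Hypothesis Gsimple : simple_graph G.

Definition induced (W : {set V}) : rel V :=
  fun x y => [&& x \in W, y \in W & G x y].

Definition connected (W : {set V}) := {in W &, forall x y, connect (induced W) x y}.

Lemma induced_sym W : symmetric (induced W).
Proof. by move=> x y; rewrite /induced Gsimple.1 andbCA. Qed.

Lemma connect_induced_sym W x y : connect (induced W) x y = connect (induced W) y x.
Proof. by apply: sym_connect_sym; apply: induced_sym. Qed.

Lemma connect_inducedS (W W' : {set V}) x y :
  W \subset W' -> connect (induced W) x y -> connect (induced W') x y.
Proof.
move=> /subsetP sW; apply: connect_sub => {}x {}y /and3P[xW yW Gxy].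
by apply: connect1; rewrite /induced !sW.
Qed.

(** Otherwise [W'] would be closed under the edges of G[W], and no path inside [W] could lead from
    [x] to [y]. *)
Lemma connected_crossing W (W' : {set V}) x y :
  connected W -> x \in W -> y \in W -> x \in W' -> y \notin W' ->
  exists a b, [/\ a \in W :&: W', b \in W, b \notin W' & G a b].
Proof.
move=> cW xW yW xW' yW'.
case: (boolP [exists a, exists b,
    [&& a \in W :&: W', b \in W, b \notin W' & G a b]]).
  by case/existsP=> a /existsP[b /and4P[*]]; exists a, b.
rewrite negb_exists => /forallP no.
have cl : closed (induced W) (mem W').
  apply: intro_closed; first exact: connect_induced_sym.
  move=> a b /and3P[aW bW Gab] aW'; apply/negPn/negP => bW'.
  have /negP[] := no a; apply/existsP; exists b.
  by rewrite inE aW bW Gab bW' aW'.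
by have := closed_connect cl (cW x y xW yW); rewrite xW' (negbTE yW').
Qed.

(** An induction principle: a proper part of [W] that contains [v] has an edge leaving it inside
    [W], so [W] is exhausted by adding one neighbour at a time. *)
Lemma connected_grow W v (A : {set V} -> Prop) :
  connected W -> v \in W -> A [set v] ->
  (forall (W' : {set V}) x y, W' \subset W -> v \in W' -> A W' -> x \in W' -> y \in W ->
     y \notin W' -> G x y -> A (y |: W')) ->
  A W.
Proof.
move=> cW vW A1 AS.
suff H m : m < #|W| -> exists W' : {set V}, [/\ W' \subset W, v \in W', A W' & #|W'| = m.+1].
  have cW0 : 0 < #|W| by apply/card_gt0P; exists v.
  have [|W' [sW _ AW' cW']] := H #|W|.-1; first by rewrite prednK.
  suff <- : W' = W by [].
  by apply/eqP; rewrite eqEcard sW cW' prednK /=.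
elim: m => [|m IH] hm; first by exists [set v]; split; rewrite ?sub1set ?cards1 ?inE.
have [|W' [sW vW' AW' cardW']] := IH; first exact: ltnW.
have [y yW yW'] : exists2 y, y \in W & y \notin W'.
  apply/subsetPn; apply/negP => /subset_leq_card; rewrite cardW'.
  by rewrite leqNgt hm.
have [a [b [/setIP[aW aW'] bW bW' Gab]]] := connected_crossing cW vW yW vW' yW'.
exists (b |: W'); split.
- by rewrite subUset sub1set bW.
- by rewrite !inE vW' orbT.
- exact: AS Gab.
- by rewrite cardsU1 bW' cardW'.
Qed.

Lemma connected1 v : connected [set v].
Proof. by move=> x y /set1P-> /set1P->; apply: connect0. Qed.

Lemma connected_join (W1 W2 : {set V}) u v :
  connected W1 -> connected W2 -> u \in W1 -> v \in W2 -> G u v ->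
  connected (W1 :|: W2).
Proof.
move=> c1 c2 uW vW Guv.
have toU x : x \in W1 :|: W2 -> connect (induced (W1 :|: W2)) x u.
  case/setUP => xW.
    by apply: connect_inducedS (c1 x u xW uW); apply: subsetUl.
  apply: connect_trans (connect_inducedS (subsetUr _ _) (c2 x v xW vW)) _.
  by apply: connect1; rewrite /induced !inE vW uW !orbT Gsimple.1.
move=> x y xW yW; apply: connect_trans (toU x xW) _.
by rewrite connect_induced_sym toU.
Qed.

(** The vertex [x], isolated in [F], gets [y] as its only neighbour. On a cycle through [x] the
    predecessor and the successor of [x] would both be [y]. *)
Lemma acyclic_attach (F : rel V) x y :
  acyclic F -> symmetric F -> (forall a, ~~ F x a) -> x != y ->
  acyclic (fun a b => [|| F a b, (a == x) && (b == y) | (a == y) && (b == x)]).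
Proof.
move=> acF symF xF xy s hs; set F' := fun a b => _ => /andP[cs us].
have F'x b : F' x b -> b = y.
  by rewrite /F' (negbTE (xF b)) eqxx (negbTE xy) /= orbF => /eqP.
have F'x' b : F' b x -> b = y.
  by rewrite /F' symF (negbTE (xF b)) eqxx [x == y](negbTE xy) andbF andbT /= => /eqP.
case: (boolP (x \in s)) => [/rot_to[i s' es]|xs]; last first.
  apply: (acF s hs); rewrite /ucycle us andbT.
  rewrite -(@eq_in_cycle _ (mem s) F' F) //.
  move=> a b aS bS; rewrite /F'.
  have /negbTE-> : a != x by apply: contraNneq xs => <-.
  have /negbTE-> : b != x by apply: contraNneq xs => <-.
  by rewrite andbF !orbF.
move: cs us hs; rewrite -(rot_cycle i) -(rot_uniq i) -(size_rot i) es.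
case: s' {es} => [|a s'] //; case: (lastP s') => [|{}s' b] //.
rewrite /= rcons_path last_rcons => /and3P[/F'x-> _ /F'x'->].
by rewrite mem_rcons in_cons eqxx andbF.
Qed.

Lemma spanning_tree W v : connected W -> v \in W ->
  exists F : rel V, subgraph G W F /\ tree W F.
Proof.
move=> cW vW.
pose A (W' : {set V}) := exists F : rel V, [/\ symmetric F,
  forall x y, F x y -> [/\ x \in W', y \in W' & G x y],
  forall x, x \in W' -> connect F x v & acyclic F].
have [F [symF sF cF acF]] : A W.
  apply: (connected_grow cW vW).
    exists (fun _ _ => false); split=> //.
    + by move=> x /set1P->; apply: connect0.
    + by case=> [|a [|b s]].
  move=> W' x y sW vW' [F [symF sF cF acF]] xW' yW yW' Gxy.
  have xy : y != x by apply: contraNneq yW' => ->.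
  have yF a : ~~ F y a by apply/negP => /sF[h _ _]; rewrite h in yW'.
  exists (fun a b => [|| F a b, (a == y) && (b == x) | (a == x) && (b == y)]); split.
  + by move=> a b; rewrite symF [in X in _ || X]orbC ![(b == _) && _]andbC.
  + move=> a b; rewrite !inE.
    case/or3P=> [/sF[-> -> ->]|/andP[/eqP-> /eqP->]|/andP[/eqP-> /eqP->]].
    * by rewrite !orbT.
    * by rewrite eqxx xW' orbT Gsimple.1.
    * by rewrite eqxx xW' orbT.
  + have cx a : a \in W' -> connect (fun a b =>
       [|| F a b, (a == y) && (b == x) | (a == x) && (b == y)]) a v.
      move=> /cF; apply: connect_sub => b c Fbc; apply: connect1; by rewrite Fbc.
    move=> a /setU1P[->|/cx//]; apply: connect_trans (cx x xW').
    by apply: connect1; rewrite !eqxx orbT.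
  + exact: acyclic_attach.
have symc : connect_sym F by exact: sym_connect_sym.
exists F; split; split=> //.
- by split=> // x; apply/negP => /sF[_ _]; rewrite Gsimple.2.
- by apply/set0Pn; exists v.
- by move=> x y xW yW; apply: connect_trans (cF x xW) _; rewrite symc cF.
Qed.

(** A tree can be traded for its vertex set: a connected set has a spanning tree, and the edges of a
    tree are edges of the induced subgraph. *)
Lemma steiner_connected (R : {set V}) k : steiner_yes G R k <->
  exists2 W, W != set0 & [/\ connected W, R \subset W & #|W :\: R| <= k].
Proof.
split=> [[W [F [[_ sF] [W0 cW _] sR ck]]]|[W /set0Pn[v vW] [cW sR ck]]].
  exists W => //; split=> // x y xW yW.
  by apply: connect_sub (cW x y xW yW) => a b /sF[aW bW Gab];
    apply: connect1; rewrite /induced aW bW.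
by have [F [sF tF]] := spanning_tree cW vW; exists W, F.
Qed.

(* The grafting form of a rooted tree follows the join step of the dynamic
   program; [rooted_leaf] shows that it still allows growing by leaves. *)
Inductive rooted : {set V} -> V -> Prop :=
| Rooted1 v : rooted [set v] v
| RootedU W1 W2 v u : rooted W1 v -> rooted W2 u -> [disjoint W1 & W2] ->
    G v u -> rooted (W1 :|: W2) v.

(** The new vertex goes into the part that contains its neighbour [x]; as it lies in neither part,
    the parts stay disjoint. *)
Lemma rooted_leaf W v x y :
  rooted W v -> x \in W -> y \notin W -> G x y -> rooted (y |: W) v.
Proof.
move=> h; elim: h x y => {W v} [v|W1 W2 v u h1 IH1 h2 IH2 dis Gvu] x y.
  move=> /set1P-> yv Gxy; rewrite setUC; apply: RootedU Gxy; [exact: Rooted1..|].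
  by rewrite disjoints1 inE eq_sym; move: yv; rewrite !inE.
rewrite !inE negb_or => xW /andP[y1 y2] Gxy; case/orP: xW => xW.
  rewrite setUA; apply: RootedU Gvu => //; first exact: IH1 Gxy.
  by rewrite disjoints_subset subUset sub1set inE y2 -disjoints_subset.
rewrite setUCA; apply: RootedU Gvu => //; first exact: IH2 Gxy.
by rewrite disjoint_sym disjoints_subset subUset sub1set inE y1 -disjoints_subset disjoint_sym.
Qed.

Lemma connected_rooted W v : connected W -> v \in W -> rooted W v.
Proof.
move=> cW vW; apply: (connected_grow (A := rooted^~ v) cW vW).
  exact: Rooted1.
by move=> W' x y _ _ h xW' _ yW' Gxy; apply: rooted_leaf Gxy.
Qed.

Lemma rooted_root W v : rooted W v -> v \in W.
Proof. by elim=> [u|W1 W2 u w _ h _ _ _ _]; rewrite !inE ?eqxx ?h. Qed.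


(** * Components of the subgraph induced by the terminals *)

Variable R : {set V}.

(** Empty when [v] is not a terminal, so that Steiner vertices contribute nothing to a union of
    components. *)
Definition component (v : V) : {set V} :=
  [set x | [&& v \in R, x \in R & connect (induced R) v x]].

Lemma component_refl v : v \in R -> v \in component v.
Proof. by move=> vR; rewrite inE vR connect0. Qed.

Lemma component_sub v : component v \subset R.
Proof. by apply/subsetP => x; rewrite inE => /and3P[]. Qed.

Lemma component_sym u v : (u \in component v) = (v \in component u).
Proof. by rewrite !inE connect_induced_sym andbCA. Qed.

Lemma component_trans v u w : u \in component v -> w \in component u -> w \in component v.
Proof.
rewrite !inE => /and3P[-> _ vu] /and3P[_ -> uw]; exact: connect_trans uw.
Qed.

Lemma component_eq u v : u \in component v -> component u = component v.
Proof.
move=> uv; apply/setP => w; apply/idP/idP; first exact: component_trans.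
by apply: component_trans; rewrite component_sym.
Qed.

Lemma component_edge v x y :
  x \in component v -> y \in R -> G x y -> y \in component v.
Proof.
move=> xv yR Gxy; have xR : x \in R by move: xv; rewrite inE => /and3P[].
apply: (component_trans xv).
by rewrite inE xR yR connect1 // /induced xR yR.
Qed.

(** Paths in G[R] must be shown to stay in the component: the part of it that is reachable from [v]
    within the component is closed under the edges of G[R]. *)
Lemma connected_component v : connected (component v).
Proof.
suff H x : x \in component v -> connect (induced (component v)) v x.
  by move=> x y /H vx /H; apply: connect_trans; rewrite connect_induced_sym.
move=> xv.
pose S := [set y in component v | connect (induced (component v)) v y].
have clS : closed (induced R) (mem S).
  apply: intro_closed; first exact: connect_induced_sym.
  move=> a b /and3P[_ bR Gab] /=; rewrite !inE -!andbA.
  move=> /and4P[vR aR va cva].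
  have av : a \in component v by rewrite inE vR aR.
  have bv := component_edge av bR Gab.
  move: (bv); rewrite inE => /and3P[_ _ ->]; rewrite vR bR /=.
  by apply: connect_trans cva (connect1 _); rewrite /induced av bv.
have /and3P[vR _ vx] : [&& v \in R, x \in R & connect (induced R) v x] by rewrite inE in xv.
have := closed_connect clS vx.
have -> : (v \in mem S) = true by rewrite !inE vR !connect0.
by move=> /esym; rewrite inE => /andP[].
Qed.

Definition hull (W : {set V}) : {set V} := \bigcup_(w in W) component w.

Lemma hull_sub (W : {set V}) : hull W \subset R.
Proof. by apply/bigcupsP => w _; apply: component_sub. Qed.

Lemma sub_hull (W : {set V}) : R \subset W -> R \subset hull W.
Proof.
move=> /subsetP RW; apply/subsetP => x xR; apply/bigcupP; exists x; first exact: RW.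
exact: component_refl.
Qed.

Lemma hull1 v : hull [set v] = component v.
Proof. by rewrite /hull big_set1. Qed.

Lemma hullU W1 W2 : hull (W1 :|: W2) = hull W1 :|: hull W2.
Proof. by rewrite /hull bigcup_setU. Qed.

Definition attained (S : {set V}) v c :=
  exists W, [/\ connected W, v \in W, S \subset W & #|W :\: R| <= c].

(** A terminal reaches its whole component free of charge; a Steiner vertex costs 1, and then [S] is
    empty. *)
Lemma attained_component v (S : {set V}) : S \subset component v -> attained S v (v \notin R).
Proof.
case: (boolP (v \in R)) => vR sS.
  exists (component v); split=> //; first exact: connected_component.
    exact: component_refl.
  by rewrite leqn0 cards_eq0 setD_eq0 component_sub.
exists [set v]; split=> //.
- exact: connected1.
- exact: set11.
- apply: subset_trans sS _; apply/subsetP => x; by rewrite [x \in component v]inE (negbTE vR).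
- by apply: leq_trans (subset_leq_card (subsetDl _ _)) _; rewrite cards1.
Qed.

Lemma attained_join (S S1 S2 : {set V}) u v c1 c2 :
  attained S1 u c1 -> attained S2 v c2 -> G u v -> S \subset S1 :|: S2 ->
  attained S u (c1 + c2).
Proof.
move=> [W1 [cW1 uW1 sW1 k1]] [W2 [cW2 vW2 sW2 k2]] Guv sS.
exists (W1 :|: W2); split.
- exact: connected_join Guv.
- by rewrite inE uW1.
- by apply: subset_trans sS _; apply: setUSS.
- rewrite setDUl; apply: leq_trans (leq_card_setU _ _) _; exact: leq_add.
Qed.

Lemma steiner_attained k : steiner_yes G R k <-> exists v, attained R v k.
Proof.
rewrite steiner_connected; split.
  by case=> W /set0Pn[v vW] [cW sR ck]; exists v, W.
by case=> v [W [cW vW sR ck]]; exists W => //; apply/set0Pn; exists v.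
Qed.

(** Such a set picks at most one terminal from each component, so its size stands for a number of
    components. *)
Definition separated (I : {set V}) :=
  I \subset R /\ {in I &, forall x y, x != y -> y \notin component x}.

End Graph.

(** * Packing of unit disks *)

Section Geometry.
Import Order.TTheory GRing.Theory Num.Theory.
Variable K : realType.

Local Open Scope ring_scope.

(** The index of the interval containing [x] when [-2, 2] is cut into three intervals of length
    4/3. *)
Definition third (x : K) : 'I_3 :=
  if x < - (2%:R / 3%:R) then inord 0 else if x < 2%:R / 3%:R then inord 1 else inord 2.

(** Points of one interval differ by at most 4/3, and 16/9 is at most 2. Two coordinates then add up
    to at most 4, the squared distance of the centres of touching disks. *)
Lemma third_close (x y : K) : x ^+ 2 <= 4%:R -> y ^+ 2 <= 4%:R -> third x = third y ->
  (x - y) ^+ 2 <= 2%:R.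
Proof.
move=> hx hy.
have [x1 x2] : - 2%:R <= x /\ x <= 2%:R by split; nra.
have [y1 y2] : - 2%:R <= y /\ y <= 2%:R by split; nra.
have ne a b : (a < 3)%N -> (b < 3)%N -> a != b -> (inord a : 'I_3) = inord b -> False.
  by move=> ha hb /eqP ab /(congr1 (@nat_of_ord 3)); rewrite !inordK //.
rewrite /third.
case: (ltP x (- (2%:R / 3%:R))) => h1; case: (ltP y (- (2%:R / 3%:R))) => h2;
 do ?[case: (ltP x (2%:R / 3%:R)) => h3]; do ?[case: (ltP y (2%:R / 3%:R)) => h4];
 by [nra | move/ne => []].
Qed.

(** Close centres have their midpoint in both disks; the converse is the parallelogram law applied
    to the vectors from the centres to [p]. *)
Lemma disks_meet (c d : K * K) :
  (exists p, in_unit_disk c p /\ in_unit_disk d p) <->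
  (c.1 - d.1) ^+ 2 + (c.2 - d.2) ^+ 2 <= 4%:R.
Proof.
case: c d => [c1 c2] [d1 d2]; rewrite /in_unit_disk /=; split.
  case=> -[p1 p2] /= [].
  have := sqr_ge0 (p1 - c1 + (p1 - d1)); have := sqr_ge0 (p2 - c2 + (p2 - d2)).
  rewrite !expr2; lra.
move=> h; exists ((c1 + d1) / 2%:R, (c2 + d2) / 2%:R) => /=.
have e (x y : K) : ((x + y) / 2%:R - x) ^+ 2 = (x - y) ^+ 2 / 4%:R by field.
have e' (x y : K) : ((x + y) / 2%:R - y) ^+ 2 = (x - y) ^+ 2 / 4%:R by field.
rewrite !e !e'; lra.
Qed.

Local Close Scope ring_scope.

(** Each [x] in [I] gets an edge [f x] from its component to a Steiner vertex, and [g] maps [x] to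
    that Steiner vertex and the grid cell of the terminal relative to it. Equal images give
    terminals that are equal or adjacent, hence in one component. *)
Lemma separated_packing (V : finType) (G : rel V) (R W I : {set V}) :
  simple_graph G -> unit_disk_graph K G -> connected G W -> R \subset W ->
  separated G R I -> 1 < #|I| -> #|I| <= 9 * #|W :\: R|.
Proof.
move=> sG [c Gc] cW RW [IR sepI] I2.
pose near x (p : V * V) :=
  [&& p.1 \in component G R x, p.2 \in W :\: R & G p.1 p.2].
have ex x : x \in I -> exists p, near x p.
  (* A second representative lies in [W] outside the component of [x], so some edge inside [W]
     leaves this component; its far end cannot be a terminal. *)
  move=> xI; have [y yI yx] : exists2 y, y \in I & y != x.
    case/card_gt1P: I2 => a [b [aI bI ab]].
    by case: (eqVneq a x) => [e|]; [exists b; rewrite // -e eq_sym|exists a].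
  have xR := subsetP IR _ xI; have yR := subsetP IR _ yI.
  have yC : y \notin component G R x by apply: sepI => //; rewrite eq_sym.
  have [a [b [/setIP[aW aC] bW bC Gab]]] := connected_crossing sG cW
    (subsetP RW _ xR) (subsetP RW _ yR) (component_refl G xR) yC.
  exists (a, b); rewrite /near /= aC inE bW Gab !andbT.
  by apply: contra bC => bR; apply: component_edge Gab.
pose f x : V * V := odflt (x, x) [pick p | near x p].
have fP x : x \in I -> near x (f x).
  move=> xI; rewrite /f; case: pickP => // no.
  by have [p] := ex x xI; rewrite no.
pose g x := ((f x).2, (third ((c (f x).1).1 - (c (f x).2).1)%R,
                       third ((c (f x).1).2 - (c (f x).2).2)%R)).
have dist a b : G a b -> (((c a).1 - (c b).1) ^+ 2 + ((c a).2 - (c b).2) ^+ 2 <= 4%:R)%R.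
  move=> Gab; have ab : a != b by apply: contraTneq Gab => ->; rewrite sG.2.
  by apply/disks_meet/Gc.
have injg : {in I &, injective g}.
  move=> x y xI yI [e2 t1 t2].
  apply/eqP/negPn/negP => xy.
  have /negP[] := sepI x y xI yI xy.
  have /and3P[xa _ Gx] := fP x xI; have /and3P[ya _ Gy] := fP y yI.
  have fyR : (f y).1 \in R := subsetP (component_sub G R y) _ ya.
  suff h : (f y).1 \in component G R x.
    by apply: (component_trans h); rewrite component_sym.
  (* The disks determine adjacency for distinct vertices only, so coinciding terminals are treated
     apart. *)
  case: (eqVneq (f x).1 (f y).1) => [<-//|ne].
  apply: (component_edge xa fyR); apply/(Gc _ _ ne)/disks_meet.
  move: (dist _ _ Gx) (dist _ _ Gy) t1 t2; rewrite e2.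
  move: (c (f x).1) (c (f y).1) (c (f y).2) => [p1 p2] [q1 q2] [r1 r2] /= dx dy.
  move=> /third_close h1 /third_close h2.
  have := sqr_ge0 (p1 - r1); have := sqr_ge0 (p2 - r2).
  have := sqr_ge0 (q1 - r1); have := sqr_ge0 (q2 - r2) => *.
  have {}h1 := h1 ltac:(lra) ltac:(lra); have {}h2 := h2 ltac:(lra) ltac:(lra).
  have -> : (p1 - q1 = (p1 - r1) - (q1 - r1))%R by ring.
  have -> : (p2 - q2 = (p2 - r2) - (q2 - r2))%R by ring.
  lra.
rewrite -(card_in_imset injg).
apply: leq_trans (subset_leq_card (_ : _ \subset setX (W :\: R) setT)) _.
  apply/subsetP => _ /imsetP[x xI ->]; rewrite inE in_setT andbT.
  by have /and3P[] := fP x xI.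
by rewrite cardsX cardsT card_prod !card_ord mulnC.
Qed.

End Geometry.

(** ** The dynamic program *)

Definition frame (vs ts : seq nat) (s s' : state) :=
  (forall x, x \notin vs -> env s' x = env s x) /\
  (forall t, t \notin ts -> arr s' t = arr s t).

Lemma frame_refl vs ts s : frame vs ts s s.
Proof. by []. Qed.

Lemma frame_eval c s : frame (modv c) (moda c) s (eval c s).
Proof. by split=> x h; [apply: eval_modv|apply: eval_moda]. Qed.

(** The invariant must tolerate any value of the counter, which the loop overwrites before each
    round and at the end. The [frame] premise records what the earlier rounds left untouched. *)
Lemma for_ind i r c s (I : nat -> state -> Prop) :
  (forall j s' x, I j s' -> I j (setv s' i x)) -> I 0 s ->
  (forall j s', j < env s r -> frame (i :: modv c) (moda c) s s' ->
     env s' i = j -> I j s' -> I j.+1 (eval c s')) ->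
  I (env s r) (eval (CFor i r c) s).
Proof.
move=> Iset I0 IS /=; apply: (Iset).
suff H m : m <= env s r -> let s' := foldl (fun s' j => eval c (setv s' i j)) s (iota 0 m) in
    I m s' /\ frame (i :: modv c) (moda c) s s' by have [] := H (env s r) (leqnn _).
elim: m => [|m IH] hm; first by [].
have [Im fr] := IH (ltnW hm).
rewrite -addn1 iotaD foldl_cat /= add0n.
set s' := foldl _ _ _ in Im fr *.
have fr' : frame (i :: modv c) (moda c) s (setv s' i m).
  split=> [x|t /fr.2 //] hx; rewrite /= upd_neq ?fr.1 //.
  by move: hx; rewrite inE negb_or => /andP[].
split; first by rewrite addn1; apply: IS => //; [rewrite /= updE|apply: Iset].
split=> [x|t] h; last by rewrite eval_moda ?fr'.2.
by rewrite eval_modv ?fr'.1 //; move: h; rewrite inE negb_or => /andP[].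
Qed.

Arguments eval : simpl never.

Definition nest (l : seq (nat * nat)) c := foldr (fun p c' => CFor p.1 p.2 c') c l.

Lemma modv_nest l c : modv (nest l c) = unzip1 l ++ modv c.
Proof. by elim: l => [|p l IH] //=; rewrite IH. Qed.

Lemma moda_nest l c : moda (nest l c) = moda c.
Proof. by elim: l => [|p l IH] //=. Qed.

(* For loops that saturate: [I] is an invariant, and [E idx] is a goal that the
   iteration [idx] achieves and that no later iteration spoils. *)
Lemma nest_ind_prefix l c pre s (I : state -> Prop) (E : seq nat -> state -> Prop) :
  uniq (unzip1 l) -> all (fun i => i \notin modv c) (unzip1 l) ->
  all (fun r => r \notin unzip1 l ++ modv c) (unzip2 l) ->
  (forall i s' x, i \in unzip1 l -> I s' -> I (setv s' i x)) ->
  (forall i s' x e, i \in unzip1 l -> E e s' -> E e (setv s' i x)) ->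
  (forall s' idx, frame (unzip1 l ++ modv c) (moda c) s s' ->
     map (env s') (unzip1 l) = idx -> all2 ltn idx (map (env s) (unzip2 l)) ->
     I s' -> [/\ I (eval c s'), forall e, E e s' -> E e (eval c s')
                & E (pre ++ idx) (eval c s')]) ->
  I s -> [/\ I (eval (nest l c) s), forall e, E e s -> E e (eval (nest l c) s)
    & forall idx, all2 ltn idx (map (env s) (unzip2 l)) ->
        E (pre ++ idx) (eval (nest l c) s)].
Proof.
elim: l pre s => [|[i r] l IH] pre s /= ul al rl HI HE HB Is.
  have [h1 h2 h3] := HB s [::] (frame_refl _ _ _) erefl isT Is.
  by split=> // -[].
move: ul al rl => /andP[il ul] /andP[ic al] /andP[ri rl].
have rl' : all (fun r => r \notin unzip1 l ++ modv c) (unzip2 l).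
  by apply: sub_all rl => x; rewrite inE negb_or => /andP[].
pose I' j s' := [/\ I s', forall e, E e s -> E e s' &
  forall a idx, a < j -> all2 ltn idx (map (env s) (unzip2 l)) ->
    E (pre ++ a :: idx) s'].
suff [h1 h2 h3] : I' (env s r) (eval (CFor i r (nest l c)) s).
  by split=> // -[//|a idx] /= /andP[]; apply: h3.
apply: for_ind.
- move=> j s' x [h1 h2 h3]; split.
  + by apply: HI => //; rewrite inE eqxx.
  + by move=> e /h2; apply: HE; rewrite inE eqxx.
  + by move=> a idx h h'; apply: HE; [rewrite inE eqxx|apply: h3].
- by split.
move=> j s' jr; rewrite modv_nest moda_nest => fr ij [h1 h2 h3].
have e2 : map (env s') (unzip2 l) = map (env s) (unzip2 l).
  apply/eq_in_map => q qr; apply: fr.1; exact: (allP rl).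
(* The prefix collects the counters of the enclosing loops. *)
have [|||g1 g2 g3] := IH (rcons pre j) s' ul al rl' _ _ _ h1.
- by move=> q s1 x hq; apply: HI; rewrite inE hq orbT.
- by move=> q s1 x e hq; apply: HE; rewrite inE hq orbT.
- move=> s1 idx fr1 eidx hidx I1.
  rewrite cat_rcons; apply: HB => //.
  + split=> [x hx|t ht]; last by rewrite fr1.2 ?fr.2.
    by rewrite fr1.1 ?fr.1 //; move: hx; rewrite inE negb_or => /andP[].
  + congr cons => //; rewrite fr1.1 // mem_cat negb_or il; exact: ic.
  + by rewrite /= jr -e2.
split=> //; first by move=> e /h2/g2.
move=> a idx; rewrite ltnS leq_eqVlt => /orP[/eqP->|aj] hidx.
  by rewrite -cat_rcons; apply: g3; rewrite e2.
exact/g2/h3.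
Qed.

Lemma nest_ind l c s (I : state -> Prop) (E : seq nat -> state -> Prop) :
  uniq (unzip1 l) -> all (fun i => i \notin modv c) (unzip1 l) ->
  all (fun r => r \notin unzip1 l ++ modv c) (unzip2 l) ->
  (forall i s' x, i \in unzip1 l -> I s' -> I (setv s' i x)) ->
  (forall i s' x e, i \in unzip1 l -> E e s' -> E e (setv s' i x)) ->
  (forall s' idx, frame (unzip1 l ++ modv c) (moda c) s s' ->
     map (env s') (unzip1 l) = idx -> all2 ltn idx (map (env s) (unzip2 l)) ->
     I s' -> [/\ I (eval c s'), forall e, E e s' -> E e (eval c s')
                & E idx (eval c s')]) ->
  I s -> I (eval (nest l c) s) /\
    forall idx, all2 ltn idx (map (env s) (unzip2 l)) -> E idx (eval (nest l c) s).
Proof.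
move=> ul al rl HI HE HB Is.
by have [h1 _ h3] := @nest_ind_prefix l c [::] s I E ul al rl HI HE HB Is.
Qed.

(* Array 0 holds the input, row [u] of array 1 the component of the terminal [u] in
   G[R], row [X] of array 2 the [X]-th union of components, and row [X] of array 3
   the values of the dynamic program for that union. *)
Notation vn := 0 (only parsing). (* number of vertices *)
Notation vpk := 1 (only parsing). (* packed input bits *)
Notation vk := 2 (only parsing).
Notation vQ := 3 (only parsing). (* offset of the input in array 0 *)
Notation vP := 4 (only parsing). (* 2 ^ (9 * k) *)
Notation vN := 5 (only parsing). (* number of rows of array 2 *)
Notation vbad := 6 (only parsing).
Notation vu := 7 (only parsing).
Notation vv := 8 (only parsing).
Notation vw := 9 (only parsing).
Notation vX := 10 (only parsing).
Notation vY := 11 (only parsing).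
Notation vZ := 12 (only parsing).
Notation vj := 13 (only parsing).
Notation vb := 14 (only parsing).
Notation vt := 15 (only parsing).

Definition enot e := ESub (EK 1) e.
(** Every nonzero value counts as true; the double negations reduce it to 1 before the addition. *)
Definition eand a b := ESub (EAdd (enot (enot a)) (enot (enot b))) (EK 1).
(** The index [x * n + y], with the product formed as a sum of [n] copies of [x]; this requires that
    [x] does not read [vb]. *)
Definition eidx x y := EAdd (ESum vb vn x) y.
Definition einp x := ELd 0 (EAdd (EV vQ) x).
Definition eR x := einp (EAdd (EK 3) x).
Definition eG x y := einp (EAdd (EAdd (EK 3) (EV vn)) (eidx x y)).
Definition ecell t x y := ELd t (eidx x y).
(** Here [x] and [y] are membership tests in the variable [vw]. The sum counts the elements of the
    first set outside the second, so zero means inclusion. *)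
Definition enotsub x y := ESum vw vn (ESub (enot (enot x)) y).

Definition closure_body :=
  CIf (eand (ecell 1 (EV vu) (EV vw)) (eand (eG (EV vw) (EV vv)) (eR (EV vv))))
    (CSt 1 (eidx (EV vu) (EV vv)) (EK 1)).

Definition closure_diag :=
  CFor vu vn (CIf (eR (EV vu)) (CSt 1 (eidx (EV vu) (EV vu)) (EK 1))).

Definition closure_round := nest [:: (vu, vn); (vw, vn); (vv, vn)] closure_body.

Definition closure_prog := CSeq closure_diag (CFor vj vn closure_round).

(** Row [vN + vX] becomes row [vX] together with the component of [vu]; adding entries yields a
    union because only being nonzero matters. The loop runs to [vP] and is cut off at [vN] by the
    test, since [vN] changes and cannot bound a loop. *)
Definition rows_copy_body :=
  CIf (ESub (EV vN) (EV vX))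
    (CSt 2 (eidx (EAdd (EV vN) (EV vX)) (EV vv))
      (EAdd (ecell 2 (EV vX) (EV vv)) (ecell 1 (EV vu) (EV vv)))).

Definition rows_copy := nest [:: (vX, vP); (vv, vn)] rows_copy_body.

(** [vt] is positive exactly when the doubled table still fits into [vP] rows; otherwise the new
    component is one too many. *)
Definition rows_step :=
  CSeq (CAsn vt (ESub (EAdd (EV vP) (EK 1)) (EAdd (EV vN) (EV vN))))
  (CSeq (CIf (EV vt) (CSeq rows_copy (CAsn vN (EAdd (EV vN) (EV vN)))))
        (CIf (enot (EV vt)) (CAsn vbad (EK 1)))).

(** Row [vN - 1] is the union of all components found so far, so a terminal outside it starts a new
    one. *)
Definition rows_prog :=
  CSeq (CAsn vN (EK 1)) (CSeq (CAsn vbad (EK 0))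
    (CFor vu vn
      (CIf (eand (eR (EV vu)) (enot (ecell 2 (ESub (EV vN) (EK 1)) (EV vu))))
        rows_step))).

Definition join_init :=
  nest [:: (vX, vP); (vv, vn)]
    (CIf (enot (enotsub (ecell 2 (EV vX) (EV vw)) (ecell 1 (EV vv) (EV vw))))
      (CSt 3 (eidx (EV vX) (EV vv)) (EAdd (EV vk) (enot (enot (eR (EV vv))))))).

(** With [k + 1 - c1] and [k + 1 - c2] stored, subtracting [k + 1] from their sum leaves
    [k + 1 - (c1 + c2)], truncated to 0 when more than [k] Steiner vertices would be used. *)
Definition join_body :=
  CIf (eand (eG (EV vu) (EV vv))
         (enot (enotsub (ecell 2 (EV vZ) (EV vw))
            (EAdd (ecell 2 (EV vX) (EV vw)) (ecell 2 (EV vY) (EV vw))))))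
    (CSeq (CAsn vt (ESub (EAdd (ecell 3 (EV vX) (EV vu)) (ecell 3 (EV vY) (EV vv)))
                         (EAdd (EV vk) (EK 1))))
      (CIf (ESub (EV vt) (ecell 3 (EV vZ) (EV vu)))
        (CSt 3 (eidx (EV vZ) (EV vu)) (EV vt)))).

Definition join_round :=
  nest [:: (vZ, vP); (vX, vP); (vY, vP); (vu, vn); (vv, vn)] join_body.

Definition join_prog := CSeq join_init (CFor vj vn join_round).

Definition answer_prog :=
  CSeq (CAsn vt (EK 0))
  (CSeq (CFor vv vn (CIf (ecell 3 (ESub (EV vN) (EK 1)) (EV vv)) (CAsn vt (EK 1))))
        (CIf (EV vbad) (CAsn vt (EK 0)))).

Lemma eval_if e c s : eval (CIf e c) s = if ev e s != 0 then eval c s else s.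
Proof. by []. Qed.

Lemma eval_st t e1 e2 s : eval (CSt t e1 e2) s = seta s t (ev e1 s) (ev e2 s).
Proof. by []. Qed.

Lemma eval_seq c1 c2 s : eval (CSeq c1 c2) s = eval c2 (eval c1 s).
Proof. by []. Qed.

Lemma eval_asn i e s : eval (CAsn i e) s = setv s i (ev e s).
Proof. by []. Qed.

Lemma ev_EV i s : ev (EV i) s = env s i.
Proof. by []. Qed.

Lemma ev_EK a s : ev (EK a) s = a.
Proof. by []. Qed.

Lemma ev_EAdd a b s : ev (EAdd a b) s = ev a s + ev b s.
Proof. by []. Qed.

Lemma ev_ESub a b s : ev (ESub a b) s = ev a s - ev b s.
Proof. by []. Qed.

(** * Correctness of the dynamic program *)

Section Correctness.
Variables (n : nat) (G : rel 'I_n) (R : {set 'I_n}) (k Q P : nat).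
Hypothesis Gsimple : simple_graph G.

Definition row (s : state) t X : {set 'I_n} := [set i : 'I_n | arr s t (X * n + i) != 0].

Lemma upd_cell a X (i : 'I_n) x Y (j : 'I_n) :
  upd a (X * n + i) x (Y * n + j) = if (Y == X) && (j == i) then x else a (Y * n + j).
Proof.
rewrite /upd; suff -> : (Y * n + j == X * n + i) = (Y == X) && (j == i) by [].
have n0 : 0 < n by apply: leq_trans (ltn_ord i).
apply/eqP/andP => [e|[/eqP-> /eqP->//]].
have := congr1 (divn^~ n) e; have := congr1 (modn^~ n) e.
rewrite !modnMDl !modn_small // !divnMDl // !divn_small // !addn0.
by move=> h ->; split=> //; apply/eqP/val_inj.
Qed.

Lemma row_seta s t X (i : 'I_n) x t' Y (j : 'I_n) :
  (j \in row (seta s t (X * n + i) x) t' Y) =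
  if [&& t' == t, Y == X & j == i] then x != 0 else j \in row s t' Y.
Proof. by rewrite !inE /=; case: (t' =P t) => [->|//] /=; rewrite upd_cell; case: ifP. Qed.

Record input_ok (s : state) : Prop := InputOk {
  ok_n : env s vn = n; ok_k : env s vk = k; ok_Q : env s vQ = Q; ok_P : env s vP = P;
  ok_R : forall i : 'I_n, (arr s 0 (Q + (3 + i)) != 0) = (i \in R);
  ok_G : forall i j : 'I_n, (arr s 0 (Q + (3 + n + (i * n + j))) != 0) = G i j }.

Lemma input_ok_frame vs ts s s' :
  frame vs ts s s' -> all (fun x => x \notin vs) [:: vn; vk; vQ; vP] -> 0 \notin ts ->
  input_ok s -> input_ok s'.
Proof.
move=> [f1 f2] /and5P[h1 h2 h3 h4 _] h0 [o1 o2 o3 o4 o5 o6].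
by split; rewrite ?f1 ?f2.
Qed.

Lemma input_ok_setv s i x :
  i \notin [:: vn; vk; vQ; vP] -> input_ok s -> input_ok (setv s i x).
Proof.
rewrite !inE !negb_or => /and4P[h1 h2 h3 h4] [o1 o2 o3 o4 o5 o6].
by split; rewrite //= upd_neq // eq_sym.
Qed.

Lemma ev_enot a s : (ev (enot a) s != 0) = (ev a s == 0).
Proof. by rewrite /=; move: (ev a s) => [|m]; rewrite ?(subSS, sub0n). Qed.

Lemma ev_eand a b s : (ev (eand a b) s != 0) = (ev a s != 0) && (ev b s != 0).
Proof.
by rewrite /=; move: (ev a s) (ev b s) => [|x] [|y]; rewrite ?(subSS, sub0n, subn0).
Qed.

Lemma ev_eidx x y s :
  env s vn = n -> (forall z, ev x (setv s vb z) = ev x s) ->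
  ev (eidx x y) s = ev x s * n + ev y s.
Proof.
move=> hn hx /=; rewrite hn (eq_bigr (fun _ => ev x s)) => [|i _]; last exact: hx.
by rewrite sum_nat_const card_ord mulnC.
Qed.

Lemma ev_eR a s (i : 'I_n) :
  input_ok s -> env s a = i -> (ev (eR (EV a)) s != 0) = (i \in R).
Proof. by move=> o ha /=; rewrite ha ok_Q // ok_R. Qed.

Lemma ev_eG a b s (i j : 'I_n) : a != vb ->
  input_ok s -> env s a = i -> env s b = j -> (ev (eG (EV a) (EV b)) s != 0) = G i j.
Proof.
move=> ab o ha hb; have hn := ok_n o.
rewrite -[ev _ _]/(arr s 0 (env s vQ + (3 + env s vn + ev (eidx (EV a) (EV b)) s))).
rewrite ev_eidx // => [|z]; last by rewrite /= upd_neq.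
by rewrite /= ha hb ok_Q // hn ok_G.
Qed.

Lemma ev_ecellE t x y s : env s vn = n ->
  (forall z, ev x (setv s vb z) = ev x s) ->
  ev (ecell t x y) s = arr s t (ev x s * n + ev y s).
Proof.
by move=> hn hx; rewrite -[LHS]/(arr s t (ev (eidx x y) s)) ev_eidx.
Qed.

Lemma ev_ecell t x b s (j : 'I_n) : env s vn = n ->
  (forall z, ev x (setv s vb z) = ev x s) -> env s b = j ->
  (ev (ecell t x (EV b)) s != 0) = (j \in row s t (ev x s)).
Proof. by move=> hn hx hb; rewrite ev_ecellE // ev_EV hb inE. Qed.

Lemma ev_enotsub s x y (A B : {set 'I_n}) : env s vn = n ->
  (forall j : 'I_n, (ev x (setv s vw j) != 0) = (j \in A)) ->
  (forall j : 'I_n, (ev y (setv s vw j) != 0) = (j \in B)) ->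
  (ev (enotsub x y) s == 0) = (A \subset B).
Proof.
move=> hn hx hy.
rewrite -[ev _ _]/(\sum_(j < env s vn) ev (ESub (enot (enot x)) y) (setv s vw j)) hn.
rewrite sum_nat_eq0; apply/forall_inP/subsetP => [h j|h j _].
  rewrite -hx -hy => jA; have := h j isT; rewrite /=; move: jA; lia.
have := h j; rewrite -hx -hy => {}h; apply/eqP => /=.
move: h; case: (ev x _) => [|a] //= h; have := h isT; lia.
Qed.

Lemma closure_diag_correct s : input_ok s -> (forall u, row s 1 u = set0) ->
  forall u v : 'I_n, (v \in row (eval closure_diag s) 1 u) = (u == v) && (u \in R).
Proof.
move=> ok r0.
have := @for_ind vu vn (CIf (eR (EV vu)) (CSt 1 (eidx (EV vu) (EV vu)) (EK 1))) s
  (fun j s' => forall u v : 'I_n, (v \in row s' 1 u) = [&& u == v, u \in R & u < j]).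
move=> /(_ _ _ _) H u v; rewrite H ?ok_n ?ltn_ord ?andbT //.
- by move=> {}u {}v; rewrite r0 inE ltn0 !andbF.
move=> j s' hj fr ej IH {}u {}v.
have ok' : input_ok s' by apply: input_ok_frame fr _ _ ok.
pose i := Ordinal hj.
have uj : (u < j.+1) = (u == i) || (u < j) by rewrite ltnS leq_eqVlt.
rewrite uj eval_if (ev_eR (i := i) ok' ej).
case: (boolP (i \in R)) => hR; last first.
  rewrite IH; case: (u =P i) => [->|//]; by rewrite (negbTE hR) !andbF.
rewrite eval_st ev_eidx ?(ok_n ok') // !ev_EV ev_EK ej (row_seta s' 1 i i) /= IH.
rewrite -[(u : nat) == j]/(u == i).
by case: (u =P i) => [->|ne] /=; rewrite ?hR ?eqxx ?[v == i]eq_sym //=; case: (i == v).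
Qed.

Lemma row_mono_seta s t X (i : 'I_n) x t' Y : x != 0 ->
  row s t' Y \subset row (seta s t (X * n + i) x) t' Y.
Proof.
move=> hx; apply/subsetP => j jY; rewrite row_seta hx; by case: ifP.
Qed.

Lemma all2_ltn2 idx a m : all2 ltn idx [:: a; m] ->
  exists x (v : 'I_m), idx = [:: x; v : nat] /\ x < a.
Proof.
case: idx => [|x [|y [|? ?]]] //=; rewrite ?andbF // => /and3P[h1 h2 _].
by exists x, (Ordinal h2).
Qed.

Lemma all2_ltn3 idx m : all2 ltn idx [:: m; m; m] ->
  exists u v w : 'I_m, idx = [:: u : nat; v : nat; w : nat].
Proof.
case: idx => [|x [|y [|z [|? ?]]]] //=; rewrite ?andbF // => /and4P[h1 h2 h3 _].
by exists (Ordinal h1), (Ordinal h2), (Ordinal h3).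
Qed.

Lemma closure_round_correct s : input_ok s ->
  (forall u : 'I_n, row s 1 u \subset component G R u) ->
  let s' := eval closure_round s in
  [/\ forall u : 'I_n, row s' 1 u \subset component G R u,
      forall u : 'I_n, row s 1 u \subset row s' 1 u
    & forall u w v : 'I_n, w \in row s 1 u -> G w v -> v \in R -> v \in row s' 1 u].
Proof.
move=> ok sound s'.
pose I s' := (forall u : 'I_n, row s' 1 u \subset component G R u) /\
  (forall u : 'I_n, row s 1 u \subset row s' 1 u).
pose E idx s' := forall u w v : 'I_n, idx = [:: u : nat; w : nat; v : nat] ->
  w \in row s 1 u -> G w v -> v \in R -> v \in row s' 1 u.
have [|[h1 h2] h3] := @nest_ind [:: (vu, vn); (vw, vn); (vv, vn)] closure_body s I E
  isT isT isT (fun _ _ _ _ h => h) (fun _ _ _ _ _ h => h) _ (conj sound (fun u => subxx _)).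
  move=> s1 idx fr eidx hidx [I1 I2]; rewrite /= ok_n // in eidx hidx.
  case/all2_ltn3: hidx => u [w [v e]]; subst idx; case: e => eu ew ev'.
  have ok1 : input_ok s1 by apply: input_ok_frame fr _ _ ok.
  have n1 := ok_n ok1.
  have -> : eval closure_body s1 =
      if [&& w \in row s1 1 u, G w v & v \in R] then seta s1 1 (u * n + v) 1 else s1.
    rewrite eval_if !ev_eand (ev_ecell _ (j := w)) // (ev_eG (i := w) (j := v)) //.
    by rewrite (ev_eR (i := v)) // eval_st ev_eidx // !ev_EV ev_EK eu ev'.
  set s2 := if _ then _ else _.
  have mono x : row s1 1 x \subset row s2 1 x.
    by rewrite /s2; case: ifP => // _; apply: row_mono_seta.
  split.
  - split=> x; last exact: subset_trans (I2 x) (mono x).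
    rewrite /s2; case: ifP => // /and3P[wu Gwv vR].
    apply/subsetP => y; rewrite row_seta /=.
    case: ifP => [/andP[/eqP exu /eqP ->] _|_]; last exact: (subsetP (I1 x)).
    have {x exu} -> : x = u by apply: val_inj.
    exact: component_edge (subsetP (I1 u) _ wu) vR Gwv.
  - by move=> e' Ee u' w' v' e2 h1 h2 h3; apply: (subsetP (mono u')); apply: Ee h1 h2 h3.
  - move=> u' w' v' [e1 e2 e3].
    have [-> -> ->] : [/\ u' = u, w' = w & v' = v] by split; apply: ord_inj; lia.
    move=> h1 h2 h3.
    by rewrite /s2 (subsetP (I2 u) _ h1) h2 h3 row_seta !eqxx.
split=> // u w v hw Gwv vR; apply: (h3 [:: u : nat; w : nat; v : nat]) hw Gwv vR => //=.
by rewrite ok_n // !ltn_ord.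
Qed.

(** After [j] rounds, row [u] of a terminal [u] contains the end of every path of at most [j] edges
    from [u] in G[R]; a path without repetitions has fewer than [n] edges. *)
Lemma closure_prog_correct s : input_ok s -> (forall u, row s 1 u = set0) ->
  forall u : 'I_n, row (eval closure_prog s) 1 u = component G R u.
Proof.
move=> ok r0 u; rewrite eval_seq.
have := closure_diag_correct ok r0.
have ok0 : input_ok (eval closure_diag s).
  exact: input_ok_frame (frame_eval closure_diag s) _ _ ok.
move: (eval closure_diag s) ok0 => s0 ok0 diag.
pose J j s' := (forall u : 'I_n, row s' 1 u \subset component G R u) /\
  forall (u : 'I_n) p, u \in R -> path (induced G R) u p -> size p <= j ->
    last u p \in row s' 1 u.
have [] : J n (eval (CFor vj vn closure_round) s0); last first.
  move=> sound comp; apply/eqP; rewrite eqEsubset sound /=.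
  apply/subsetP => x; rewrite inE => /and3P[uR _ /connectP[p up ->]].
  have [p' up' un _] := shortenP up; apply: comp => //.
  have := card_uniqP un; have := max_card (mem (u :: p')).
  by rewrite card_ord /= => h e; move: h; rewrite e => /ltnW.
rewrite -{1}(ok_n ok0); apply: for_ind => //.
  split=> [v|v [|//] vR _ _ /=]; last by rewrite diag eqxx.
  apply/subsetP => x; rewrite diag => /andP[/eqP <- vR]; exact: component_refl.
move=> j s1 hj fr ej [J1 J2].
have ok1 : input_ok s1 by apply: input_ok_frame fr _ _ ok0.
have [h1 h2 h3] := closure_round_correct ok1 J1.
split=> // v p vR; case: (lastP p) => [|p' x] pp.
  by move=> _; apply: (subsetP (h2 v)); apply: (J2 v [::]).
rewrite size_rcons ltnS last_rcons => hp.
move: pp; rewrite rcons_path => /andP[pp /and3P[_ xR Gx]].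
by apply: h3 Gx xR; apply: J2.
Qed.

Definition hull_rows s :=
  forall W : {set 'I_n}, exists2 X, X < P & row s 2 X = hull G R W.

(** Rows below [vN] are only read and rows from [vN] on are only written, so no copy disturbs a
    later one. *)
Lemma rows_copy_correct s (i : 'I_n) : input_ok s -> env s vu = i ->
  env s vN + env s vN <= P ->
  let s' := eval rows_copy s in
  (forall X, X < env s vN -> row s' 2 X = row s 2 X) /\
  (forall X, X < env s vN -> row s' 2 (env s vN + X) = row s 2 X :|: row s 1 i).
Proof.
move=> ok hi; set N := env s vN => NP s'.
pose I s' := forall X, X < N -> row s' 2 X = row s 2 X.
pose E idx s' := forall X (v : 'I_n), idx = [:: X; v : nat] -> X < N ->
  (v \in row s' 2 (N + X)) = (v \in row s 2 X :|: row s 1 i).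
have [|//|h1 h2] := @nest_ind [:: (vX, vP); (vv, vn)] rows_copy_body s I E
  isT isT isT (fun _ _ _ _ h => h) (fun _ _ _ _ _ h => h).
  move=> s1 idx fr eidx hidx I1; rewrite /= ok_n // in eidx hidx.
  case/all2_ltn2: hidx => X [v [e hX]]; subst idx; case: e => eX ev'.
  have ok1 : input_ok s1 by apply: input_ok_frame fr _ _ ok.
  have n1 := ok_n ok1.
  have N1 : env s1 vN = N by apply: fr.1.
  have u1 : env s1 vu = i by rewrite -hi; apply: fr.1.
  have r1 : row s1 1 = row s 1 by rewrite /row fr.2.
  have ecell2 t a (j : 'I_n) : (arr s1 t (a * n + j) != 0) = (j \in row s1 t a).
    by rewrite inE.
  have -> : eval rows_copy_body s1 = if X < N then
      seta s1 2 ((N + X) * n + v) (arr s1 2 (X * n + v) + arr s1 1 (i * n + v)) else s1.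
    rewrite eval_if [ev (ESub _ _) _]/= N1 eX subn_eq0 -ltnNge.
    by rewrite eval_st ev_eidx // !ev_EAdd !ev_ecellE // !ev_EV N1 eX ev' u1.
  case: ltnP => XN; last first.
    by split=> // X' v' [e1 e2] XN'; lia.
  have step X' v' : (v' \in row (seta s1 2 ((N + X) * n + v)
        (arr s1 2 (X * n + v) + arr s1 1 (i * n + v))) 2 (N + X')) =
      if (X' == X) && (v' == v) then v' \in row s 2 X :|: row s 1 i
      else v' \in row s1 2 (N + X').
    rewrite row_seta eqxx /= eqn_add2l; case: (v' =P v) => [->|]; rewrite ?andbF //.
    by rewrite addn_eq0 negb_and !ecell2 r1 I1 // in_setU.
  split.
  - move=> Y YN; rewrite -I1 //; apply/setP => y; rewrite row_seta /=.
    by case: eqP => [eY|//]; move: YN; rewrite eY; lia.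
  - move=> e' Ee X' v' e2 XN'; rewrite step; case: ifP => [/andP[/eqP-> _]//|_].
    exact: Ee.
  - move=> X' v' [e1 e2] XN'; have -> : v' = v by apply: ord_inj; lia.
    have -> : X' = X by lia.
    by rewrite step !eqxx.
split=> // X XN; apply/setP => v; apply: (h2 [:: X; v : nat]) => //=.
by rewrite ok_P // ok_n // ltn_ord andbT; move: XN NP; rewrite -/N; lia.
Qed.

Lemma rows_step_correct s (i : 'I_n) : input_ok s -> env s vu = i ->
  let N := env s vN in let s' := eval rows_step s in
  if N + N <= P then
    [/\ env s' vN = N + N, env s' vbad = env s vbad,
      forall X, X < N -> row s' 2 X = row s 2 X
      & forall X, X < N -> row s' 2 (N + X) = row s 2 X :|: row s 1 i]
  else [/\ env s' vN = N, env s' vbad != 0 & arr s' = arr s].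
Proof.
move=> ok hi N; rewrite eval_seq eval_asn.
have -> : ev (ESub (EAdd (EV vP) (EK 1)) (EAdd (EV vN) (EV vN))) s = P + 1 - (N + N).
  by rewrite /= ok_P.
set s1 := setv s vt _.
have ok1 : input_ok s1 by apply: input_ok_setv.
rewrite eval_seq (eval_if (EV vt)).
have -> : (ev (EV vt) s1 != 0) = (N + N <= P) by rewrite /= subn_eq0 -ltnNge addn1 ltnS.
case: ifP => h.
  set s2 := eval _ s1; rewrite eval_if.
  have t2 : env s2 vt = P + 1 - (N + N) by rewrite /s2 eval_modv.
  have -> : (ev (enot (EV vt)) s2 != 0) = false.
    by rewrite ev_enot ev_EV t2 subn_eq0 addn1 ltnNge h.
  rewrite /s2 eval_seq eval_asn.
  have [h1 h2] := @rows_copy_correct s1 i ok1 hi h.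
  set s3 := eval rows_copy s1 in h1 h2 *.
  have f3 : env s3 vN = N by rewrite /s3 eval_modv.
  split=> //; first by rewrite -[LHS]/(env s3 vN + env s3 vN) f3.
  by rewrite -[LHS]/(env s3 vbad) /s3 eval_modv.
rewrite eval_if.
have -> : ev (enot (EV vt)) s1 != 0.
  by rewrite ev_enot /= subn_eq0 addn1 ltnNge h.
by [].
Qed.

Hypothesis P_def : P = 2 ^ (9 * k).

(** [I] consists of one representative for each component entered in the table, whose [2 ^ #|I|]
    rows comprise the unions over all subsets of [I], the full union last. Once [vbad] is set, a
    witness of more than [9 * k] components replaces the claim that the terminals below [j] are
    covered. *)
Definition rows_inv (j : nat) s := exists I : {set 'I_n}, [/\ separated G R I,
  env s vN = 2 ^ #|I| /\ 2 ^ #|I| <= P,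
  row s 2 (2 ^ #|I| - 1) = hull G R I,
  forall J : {set 'I_n}, J \subset I -> exists2 X, X < 2 ^ #|I| & row s 2 X = hull G R J
  & if env s vbad == 0 then forall i : 'I_n, i \in R -> i < j -> i \in hull G R I
    else exists2 I', separated G R I' & 9 * k < #|I'|].

Lemma separated_add I r : separated G R I -> r \in R -> r \notin hull G R I ->
  separated G R (r |: I) /\ r \notin I.
Proof.
move=> [IR sep] rR rI; split; last first.
  by apply: contra rI => h; apply/bigcupP; exists r => //; apply: component_refl.
split; first by rewrite subUset sub1set rR.
have far y : y \in I -> r \notin component G R y.
  by move=> yI; apply: contra rI => h; apply/bigcupP; exists y.
move=> x y /setU1P[->|xI] /setU1P[->|yI] xy.
- by rewrite eqxx in xy.
- by rewrite component_sym // far.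
- exact: far.
- exact: sep.
Qed.

Lemma rows_prog_correct s : input_ok s -> (forall X, row s 2 X = set0) ->
  (forall u : 'I_n, row s 1 u = component G R u) ->
  rows_inv n (eval rows_prog s).
Proof.
move=> ok r0 r1; rewrite !eval_seq !eval_asn !ev_EK.
set s0 := setv (setv s vN 1) vbad 0.
have ok0 : input_ok s0 by do 2 apply: input_ok_setv => //.
rewrite -{1}(ok_n ok0); apply: for_ind.
- by [].
- have hull0 : hull G R set0 = set0 by rewrite /hull big_set0.
  exists set0; rewrite cards0 hull0; split=> //.
  + by split; [apply: sub0set|move=> x y; rewrite inE].
  + by rewrite P_def expn_gt0.
  + by rewrite -[LHS]/(row s 2 _) r0.
  + by move=> J; rewrite subset0 => /eqP->; exists 0; rewrite ?hull0 // -[LHS]/(row s 2 _) r0.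
move=> j s1 hj fr ej [I [sepI [eN NP] last_row rows done]].
rewrite (ok_n ok0) in hj; pose i := Ordinal hj.
have ok1 : input_ok s1 by apply: input_ok_frame fr _ _ ok0.
have r1' : row s1 1 = row s 1 by rewrite /row fr.2.
rewrite eval_if ev_eand ev_enot -[ev (ecell _ _ _) _ == 0]negbK.
rewrite (ev_ecell _ (j := i)) ?(ok_n ok1) // (ev_eR (i := i)) //.
have -> : ev (ESub (EV vN) (EK 1)) s1 = 2 ^ #|I| - 1 by rewrite /= eN.
rewrite last_row; case: ifP => [/andP[iR iI]|h]; last first.
  exists I; split=> //; case: ifP done => // _ done i' iR; rewrite ltnS leq_eqVlt.
  case/orP=> [/eqP e|]; last exact: done.
  have ei : i' = i by apply: val_inj.
  by move: h; rewrite -ei iR => /negbFE.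
have [sepI' iI'] := separated_add sepI iR iI.
have cI : #|i |: I| = #|I|.+1 by rewrite cardsU1 iI'.
have := @rows_step_correct s1 i ok1 ej; rewrite /= eN addnn -mul2n -expnS -cI.
case: ifP => hP; last first.
  move=> [h1 h2 h3]; exists I; rewrite h1 /row h3 (negbTE h2); split=> //.
  (* The table could not be doubled: two to the number of representatives, now including [i],
     exceeds [2 ^ (9 * k)]. *)
  exists (i |: I) => //; move: hP; rewrite P_def leq_exp2l // => /negbT.
  by rewrite -ltnNge.
move=> [h1 h2 h3 h4]; exists (i |: I); rewrite h1 h2.
have r1i : row s1 1 j = component G R i by rewrite r1'; apply: (r1 i).
have pos : 0 < 2 ^ #|I| by rewrite expn_gt0.
have half : 2 ^ #|i |: I| = 2 ^ #|I| + 2 ^ #|I| by rewrite cI expnS mul2n addnn.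
have hulli J : hull G R (i |: J) = hull G R J :|: component G R i by rewrite hullU hull1 setUC.
split=> //.
- rewrite half -addnBA // h4 ?last_row ?r1i ?hulli //; lia.
- move=> J sJ; have [X XN eX] := rows (J :\ i) ltac:(by rewrite subDset).
  (* A union that involves [i] sits in the new half, at the position of the same union without [i]
     in the old half. *)
  case: (boolP (i \in J)) => iJ.
    by exists (2 ^ #|I| + X); rewrite ?half ?ltn_add2l // h4 // eX r1i -hulli setD1K.
  exists X; first by rewrite half ltn_addr.
  by rewrite h3 // eX; congr hull; apply/setDidPl; rewrite disjoint_sym disjoints1.
- case: ifP done => // _ done i' i'R; rewrite ltnS leq_eqVlt hulli inE.
  case/orP=> [/eqP e|/done -> //].
  have -> : i' = i by apply: val_inj.
  by rewrite component_refl ?orbT.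
Qed.

Lemma all2_ltn5 idx a m : all2 ltn idx [:: a; a; a; m; m] ->
  exists x y z (u v : 'I_m),
    [/\ idx = [:: x; y; z; u : nat; v : nat], x < a, y < a & z < a].
Proof.
case: idx => [|x [|y [|z [|u [|v [|? ?]]]]]] //=; rewrite ?andbF //.
move=> /and5P[h1 h2 h3 h4 /andP[h5 _]].
by exists x, y, z, (Ordinal h4), (Ordinal h5).
Qed.

(* Array 3 stores [k.+1] minus the number of Steiner vertices, so that the
   initial value 0 means that no set of at most [k] vertices is known. *)
Definition gain_sound (D : nat -> {set 'I_n}) (a : nat -> nat) :=
  forall Z (v : 'I_n), 0 < a (Z * n + v) -> a (Z * n + v) <= k.+1 /\
    attained G R (D Z) v (k.+1 - a (Z * n + v)).

Lemma join_init_correct s : input_ok s -> (forall a, arr s 3 a = 0) ->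
  (forall u : 'I_n, row s 1 u = component G R u) ->
  let s' := eval join_init s in
  gain_sound (row s 2) (arr s' 3) /\
  forall X (v : 'I_n), X < P -> row s 2 X \subset component G R v ->
    k + (v \in R) <= arr s' 3 (X * n + v).
Proof.
move=> ok a0 r1 s'.
pose I s' := gain_sound (row s 2) (arr s' 3).
pose E idx s' := forall X (v : 'I_n), idx = [:: X; v : nat] ->
  row s 2 X \subset component G R v -> k + (v \in R) <= arr s' 3 (X * n + v).
have [||h1 h2] := @nest_ind [:: (vX, vP); (vv, vn)]
  (CIf (enot (enotsub (ecell 2 (EV vX) (EV vw)) (ecell 1 (EV vv) (EV vw))))
      (CSt 3 (eidx (EV vX) (EV vv)) (EAdd (EV vk) (enot (enot (eR (EV vv))))))) s I E
  isT isT isT (fun _ _ _ _ h => h) (fun _ _ _ _ _ h => h).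
- move=> s1 idx fr eidx hidx I1; rewrite /= ok_n // in eidx hidx.
  case/all2_ltn2: hidx => X [v [e hX]]; subst idx; case: e => eX ev'.
  have ok1 : input_ok s1 by apply: input_ok_frame fr _ _ ok.
  have n1 := ok_n ok1.
  have row1 t : t != 3 -> row s1 t = row s t.
    by move=> t3; rewrite /row fr.2 // mem_seq1.
  set body := CIf _ _.
  have -> : eval body s1 = if row s 2 X \subset component G R v then
      seta s1 3 (X * n + v) (k + (v \in R)) else s1.
    rewrite eval_if ev_enot (ev_enotsub (A := row s 2 X) (B := component G R v)) //.
    - rewrite eval_st ev_eidx // ev_EAdd !ev_EV eX ev' (ok_k ok1).
      by rewrite -(ev_eR ok1 ev') /=; case: (arr _ _ _).
    - by move=> j; rewrite (ev_ecell _ (j := j)) // ev_EV /= -row1 // -eX.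
    - by move=> j; rewrite (ev_ecell _ (j := j)) // ev_EV /= -r1 -row1 // -ev'.
  case: ifP => hsub; last first.
    split=> // X' v' [e1 e2]; have -> : v' = v by apply: ord_inj; lia.
    have -> : X' = X by lia.
    by rewrite hsub.
  split.
  + move=> Z w /=; rewrite upd_cell; case: ifP => [/andP[/eqP-> /eqP->] _|_]; last exact: I1.
    split; first by case: (v \in R); lia.
    have -> : k.+1 - (k + (v \in R)) = (v \notin R) by case: (v \in R) => /=; lia.
    exact: attained_component.
  + move=> e' Ee X' v' e2 sub /=; rewrite upd_cell.
    by case: ifP => [/andP[_ /eqP->]//|_]; apply: Ee.
  + move=> X' v' [e1 e2] _; have -> : v' = v by apply: ord_inj; lia.
    have -> : X' = X by lia.
    by rewrite /= upd_cell !eqxx.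
- by move=> Z v; rewrite a0.
split=> // X v XP; apply: (h2 [:: X; v : nat]) => //=.
by rewrite ok_P // ok_n // XP ltn_ord.
Qed.

Lemma join_body_correct s X Y Z (u v : 'I_n) : input_ok s ->
  map (env s) [:: vZ; vX; vY; vu; vv] = [:: Z; X; Y; u : nat; v : nat] ->
  let new := arr s 3 (X * n + u) + arr s 3 (Y * n + v) - k.+1 in
  arr (eval join_body s) 3 =
    if G u v && (row s 2 Z \subset row s 2 X :|: row s 2 Y) && (arr s 3 (Z * n + u) < new)
    then upd (arr s 3) (Z * n + u) new else arr s 3.
Proof.
move=> ok [eZ eX eY eu ev'] new; have hn := ok_n ok.
rewrite eval_if ev_eand (ev_eG (i := u) (j := v)) //.
rewrite ev_enot (ev_enotsub (A := row s 2 Z) (B := row s 2 X :|: row s 2 Y)) //; first last.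
- move=> j; rewrite ev_EAdd addn_eq0 negb_and !(ev_ecell _ (j := j)) // !ev_EV in_setU -eX -eY; reflexivity.
- by move=> j; rewrite (ev_ecell _ (j := j)) // !ev_EV -eZ.
case: ifP => //= _.
rewrite eval_seq eval_asn.
have -> : ev (ESub (EAdd (ecell 3 (EV vX) (EV vu)) (ecell 3 (EV vY) (EV vv)))
     (EAdd (EV vk) (EK 1))) s = new.
  by rewrite ev_ESub !ev_EAdd !ev_ecellE // !ev_EV eX eY eu ev' ev_EK (ok_k ok) addn1.
rewrite eval_if ev_ESub ev_ecellE // !ev_EV subn_eq0 -ltnNge.
rewrite -[env (setv _ _ _) vt]/new -[env (setv _ _ _) vZ]/(env s vZ).
rewrite -[env (setv _ _ _) vu]/(env s vu) eZ eu /=.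
case: ifP => // _.
rewrite eval_st ev_eidx // !ev_EV -[env (setv _ _ _) vt]/new.
rewrite -[env (setv _ _ _) vZ]/(env s vZ) -[env (setv _ _ _) vu]/(env s vu) eZ eu.
by [].
Qed.

(** Updates happen in place, so an iteration may read values already improved in the same round.
    Soundness is preserved by each update, and since entries only grow, the lower bound in terms of
    the values at the start of the round holds. *)
Lemma join_round_correct s : input_ok s -> gain_sound (row s 2) (arr s 3) ->
  let s' := eval join_round s in
  [/\ gain_sound (row s 2) (arr s' 3), forall p, arr s 3 p <= arr s' 3 p
    & forall Z X Y (u v : 'I_n), Z < P -> X < P -> Y < P -> G u v ->
        row s 2 Z \subset row s 2 X :|: row s 2 Y ->
        arr s 3 (X * n + u) + arr s 3 (Y * n + v) - k.+1 <= arr s' 3 (Z * n + u)].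
Proof.
move=> ok sound s'.
pose I s' := gain_sound (row s 2) (arr s' 3) /\ forall p, arr s 3 p <= arr s' 3 p.
pose E idx s' := forall Z X Y (u v : 'I_n), idx = [:: Z; X; Y; u : nat; v : nat] ->
  G u v -> row s 2 Z \subset row s 2 X :|: row s 2 Y ->
  arr s 3 (X * n + u) + arr s 3 (Y * n + v) - k.+1 <= arr s' 3 (Z * n + u).
have [|//|[h1 h2] h3] := @nest_ind [:: (vZ, vP); (vX, vP); (vY, vP); (vu, vn); (vv, vn)]
  join_body s I E isT isT isT (fun _ _ _ _ h => h) (fun _ _ _ _ _ h => h).
  move=> s1 idx fr eidx hidx [I1 I2]; rewrite /= ok_n // in hidx.
  case/all2_ltn5: hidx => Z [X [Y [u [v [e hZ hX hY]]]]].
  have ok1 : input_ok s1 by apply: input_ok_frame fr _ _ ok.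
  have r2 : row s1 2 = row s 2 by rewrite /row fr.2.
  have := join_body_correct ok1 (etrans eidx e); rewrite r2 /=.
  set new := _ - _ => a2.
  have mono p : arr s1 3 p <= arr (eval join_body s1) 3 p.
    rewrite a2; case: ifP => // /andP[_ lt]; rewrite /upd; case: eqP => // ->; exact: ltnW.
  split.
  - split=> [W w|p]; last exact: leq_trans (I2 p) (mono p).
    rewrite a2; case: ifP => [/andP[/andP[Guv sub] lt]|_]; last exact: I1.
    rewrite upd_cell; case: ifP => [/andP[/eqP-> /eqP->] new0|_]; last exact: I1.
    (* As entries are at most [k.+1], a positive [new] forces both summands to be positive, and
       soundness applies to each. *)
    have le Y' (w' : 'I_n) : arr s1 3 (Y' * n + w') <= k.+1.
      by case: (posnP (arr s1 3 (Y' * n + w'))) => [->//|h]; have [] := I1 _ _ h.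
    have := le X u; have := le Y v; rewrite /new in new0 * => ly lx.
    have [|_ at1] := I1 X u; first by lia.
    have [|_ at2] := I1 Y v; first by lia.
    split; first by lia.
    rewrite (_ : _ - _ = k.+1 - arr s1 3 (X * n + u) + (k.+1 - arr s1 3 (Y * n + v))).
      exact: attained_join at1 at2 Guv sub.
    by lia.
  - move=> e' Ee Z' X' Y' u' v' e2 Guv sub; exact: leq_trans (Ee _ _ _ _ _ e2 Guv sub) (mono _).
  - rewrite e => Z' X' Y' u' v' [<- <- <- e1 e2] Guv sub.
    have [-> ->] : u' = u /\ v' = v by split; apply: ord_inj; lia.
    have eu : u' = u by apply: ord_inj; lia.
    have ev' : v' = v by apply: ord_inj; lia.
    subst u' v'; apply: leq_trans (_ : new <= _).
      by rewrite /new; apply: leq_sub2r; apply: leq_add.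
    rewrite a2 Guv sub /=; case: ltnP => // _; rewrite upd_cell !eqxx.
    by [].
split=> // Z X Y u v ZP XP YP; apply: (h3 [:: Z; X; Y; u : nat; v : nat]) => //=.
by rewrite ok_P // ok_n // ZP XP YP !ltn_ord.
Qed.

Lemma rooted_card W v : rooted G W v -> 0 < #|W|.
Proof. by move/rooted_root => h; apply/card_gt0P; exists v. Qed.

(** Induction on the rounds: after [j] of them the entries are good enough for rooted trees with at
    most [j + 1] vertices, because both parts of a grafted tree are smaller and were settled one
    round earlier. The parts are looked up in the rows of their hulls. *)
Lemma join_prog_correct s : input_ok s -> (forall a, arr s 3 a = 0) ->
  (forall u : 'I_n, row s 1 u = component G R u) -> hull_rows s ->
  let s' := eval join_prog s in
  gain_sound (row s 2) (arr s' 3) /\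
  forall W v, rooted G W v -> forall Z, Z < P -> row s 2 Z \subset hull G R W ->
    k.+1 - #|W :\: R| <= arr s' 3 (Z * n + v).
Proof.
move=> ok a0 r1 rows; rewrite eval_seq.
have := join_init_correct ok a0 r1.
have ok0 : input_ok (eval join_init s).
  exact: input_ok_frame (frame_eval join_init s) _ _ ok.
have : row (eval join_init s) 2 = row s 2 by rewrite /row eval_moda.
move: (eval join_init s) ok0 => s0 ok0 rr [sound0 init0].
pose J j s' := gain_sound (row s 2) (arr s' 3) /\
  forall W v, rooted G W v -> #|W| <= j.+1 -> forall Z, Z < P ->
    row s 2 Z \subset hull G R W -> k.+1 - #|W :\: R| <= arr s' 3 (Z * n + v).
have [h1 h2] : J n (eval (CFor vj vn join_round) s0); last first.
  split=> // W v rW; apply: h2 => //.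
  by apply: leq_trans (max_card _) _; rewrite card_ord.
rewrite -{1}(ok_n ok0).
(* Single vertices are settled by the initialization and remain so, as entries never decrease. *)
have single v Z s' : (forall p, arr s0 3 p <= arr s' 3 p) -> Z < P ->
    row s 2 Z \subset hull G R [set v] -> k.+1 - #|[set v] :\: R| <= arr s' 3 (Z * n + v).
  rewrite hull1 => mono ZP sub; apply: leq_trans (mono _).
  apply: leq_trans (init0 Z v ZP sub).
  case: (boolP (v \in R)) => vR; first by rewrite addn1 leq_subr.
  have -> : [set v] :\: R = [set v].
    by apply/setDidPl; rewrite disjoints1.
  by rewrite cards1 subn1 addn0.
pose J' j s' := (forall p, arr s0 3 p <= arr s' 3 p) /\ J j s'.
suff [] : J' (env s0 vn) (eval (CFor vj vn join_round) s0) by [].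
apply: for_ind => //.
  split=> //; split=> // W v [{}v _ Z ZP sub|W1 W2 {}v u r1' r2' dis _]; first exact: single.
  have := rooted_card r1'; have := rooted_card r2'.
  by move: dis; rewrite -leq_card_setU => /eqP ->; lia.
move=> j s1 hj fr ej [J0 [J1 J2]].
have ok1 : input_ok s1 by apply: input_ok_frame fr _ _ ok0.
have rr1 : row s1 2 = row s 2 by rewrite -rr /row fr.2.
have := join_round_correct ok1; rewrite rr1 => /(_ J1)[h1 h2 h3].
have mono p : arr s0 3 p <= arr (eval join_round s1) 3 p by apply: leq_trans (h2 p).
split=> //; split=> // W v [{}v _ Z ZP sub|W1 W2 {}v u r1' r2' dis Gvu]; first exact: single.
have c1 := rooted_card r1'; have c2 := rooted_card r2'.
have cU : #|W1 :|: W2| = #|W1| + #|W2|.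
  by apply/eqP; rewrite eq_sym -leq_card_setU in dis *; rewrite eq_sym.
rewrite cU => hj2 Z ZP; rewrite hullU => sub.
have [X XP eX] := rows W1; have [Y YP eY] := rows W2.
have g1 : k.+1 - #|W1 :\: R| <= arr s1 3 (X * n + v).
  by apply: J2 => //; [lia|rewrite eX].
have g2 : k.+1 - #|W2 :\: R| <= arr s1 3 (Y * n + u).
  by apply: J2 => //; [lia|rewrite eY].
have := h3 Z X Y v u ZP XP YP Gvu; rewrite eX eY => /(_ sub); apply: leq_trans.
(* The parts are disjoint, so their costs add up exactly. *)
have -> : #|(W1 :|: W2) :\: R| = #|W1 :\: R| + #|W2 :\: R|.
  rewrite setDUl; apply/eqP; rewrite leq_card_setU.
  by apply: disjointWl (subsetDl _ _) (disjointWr (subsetDl _ _) dis).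
lia.
Qed.

Lemma answer_prog_correct s : input_ok s ->
  env (eval answer_prog s) vt != 0 <->
  env s vbad = 0 /\ exists v : 'I_n, arr s 3 ((env s vN - 1) * n + v) != 0.
Proof.
move=> ok; rewrite !eval_seq eval_asn ev_EK.
set s0 := setv s vt 0; have ok0 : input_ok s0 by apply: input_ok_setv.
pose J j s' := (env s' vt != 0) <->
  exists2 v : 'I_n, v < j & arr s 3 ((env s vN - 1) * n + v) != 0.
set body := CIf _ (CAsn vt (EK 1)).
have : J (env s0 vn) (eval (CFor vv vn body) s0).
  apply: for_ind => //.
    by split=> // -[].
  move=> j s1 hj fr ej J1; rewrite (ok_n ok0) in hj; pose i := Ordinal hj.
  have ok1 : input_ok s1 by apply: input_ok_frame fr _ _ ok0.
  have -> : eval body s1 = if arr s 3 ((env s vN - 1) * n + i) != 0 then setv s1 vt 1 else s1.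
    rewrite eval_if ev_ecellE ?(ok_n ok1) // ev_ESub !ev_EV ev_EK eval_asn ev_EK ej.
    by rewrite fr.2 // fr.1.
  case: ifP => hi; first by split=> // _; exists i => //=.
  split.
    by case/J1 => v vj hv; exists v => //; apply: ltnW.
  case=> v; rewrite ltnS leq_eqVlt => /orP[/eqP e|vj] hv; last by apply/J1; exists v.
  have ei : v = i by apply: ord_inj.
  by rewrite ei hi in hv.
have fbad : env (eval (CFor vv vn body) s0) vbad = env s vbad by rewrite eval_modv.
move: (eval (CFor vv vn body) s0) fbad => s1 fbad J1.
rewrite eval_if ev_EV fbad eval_asn ev_EK; case: (env s vbad =P 0) => [e|ne] /=.
  split=> [/J1[v _ hv]|[_ [v hv]]]; first by split=> //; exists v.
  by apply/J1; exists v => //; rewrite ok_n.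
by split=> // -[/ne].
Qed.


End Correctness.

(** ** Reading the input *)

Definition double_P := CAsn vP (EAdd (EV vP) (EV vP)).

(** [vQ] is the length of the input, and nine doublings in each of [k] rounds bring [vP] to
    [2 ^ (9 * k)]. *)
Definition init_prog :=
  CSeq (CAsn vQ (EAdd (ESum vb vn (EV vn)) (EAdd (EV vn) (EK 3))))
  (CSeq (CAsn vP (EK 1)) (CFor vj vk (iter 8 (CSeq double_P) double_P))).

(** Behind the first [nr] registers the input is spread over all four arrays. It is gathered in
    array 0, input register [p] going to cell [vQ + p]; the shift by the input length keeps the
    targets away from source cells still to be read. *)
Definition copy_cell t :=
  CSt 0 (EAdd (EAdd (EV vQ) (EK (nr + t)))
              (EAdd (EAdd (EV vu) (EV vu)) (EAdd (EV vu) (EV vu))))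
    (ELd t (EV vu)).

Definition clear_cell t := CSt t (EV vu) (EK 0).

Definition copy_body :=
  CSeq (copy_cell 0) (CSeq (copy_cell 1) (CSeq (copy_cell 2) (CSeq (copy_cell 3)
    (CSeq (clear_cell 1) (CSeq (clear_cell 2) (clear_cell 3)))))).

Definition copy_prog := CFor vu vQ copy_body.

(** The highest bit is split off first: [test] is nonzero exactly when the packed number is at least
    [2 ^ q']. The number of bits is fixed, so the recursion is unrolled into the program. *)
Fixpoint unpack_prog q :=
  if q is q'.+1 then
    let test := ESub (EAdd (EV vpk) (EK 1)) (EK (2 ^ q')) in
    CSeq (CSt 0 (EAdd (EV vQ) (EK (3 + q'))) test)
      (CSeq (CIf test (CAsn vpk (ESub (EV vpk) (EK (2 ^ q'))))) (unpack_prog q'))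
  else CAsn vt (EK 0).

(* The input occupies the registers from 0 on, so there is no free register at the
   start. From register 3 on it consists of bits, and those below [nr] are packed
   into register 1, whose content [t] is not needed. *)
Fixpoint pack_code p d : seq instr :=
  if d is d'.+1 then pack_code p.+1 d' ++ [:: Add 1 1 1; Add 1 1 p]
  else [:: Defs.Sub 1 1 1].

Fixpoint packed (m : memory) p d : nat :=
  if d is d'.+1 then m p + 2 * packed m p.+1 d' else 0.

(** [packed] splits off the lowest bit, whereas unpacking needs the highest. *)
Lemma packedSr m p d : packed m p d.+1 = packed m p d + 2 ^ d * m (p + d).
Proof.
elim: d p => [|d IH] p; first by rewrite /= muln0 !addn0 expn0 mul1n.
rewrite -[LHS]/(m p + 2 * packed m p.+1 d.+1) IH.
by rewrite -[packed m p d.+1]/(m p + 2 * packed m p.+1 d) mulnDr addnA mulnA -expnS addSnnS.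
Qed.

Lemma packed_lt m p d : (forall q, m (p + q) <= 1) -> packed m p d < 2 ^ d.
Proof.
move=> hm; elim: d => [|d IH] //; rewrite packedSr expnS mul2n -addnn.
by case: (m (p + d)) (hm d) => [|[|]] //; lia.
Qed.

Lemma pack_correct P p d pc m :
  1 < p -> code_at P pc (pack_code p d) ->
  exists m', [/\ reach P (2 * d + 1) (pc, m) (pc + size (pack_code p d), m'),
    m' 1 = packed m p d & forall x, x != 1 -> m' x = m x].
Proof.
elim: d p pc => [|d IH] p pc hp /=.
  move=> /code_at_cons[i0 _]; eexists; split.
  - by run i0; rewrite addn1; apply: reach_refl.
  - by rewrite updE subnn.
  - by move=> x hx; rewrite upd_neq.
move=> /code_at_cat[c0 /code_at_cons[i0 /code_at_cons[i1 _]]].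
have [m1 [r1 v1 f1]] := IH p.+1 pc (ltnW hp) c0.
eexists; split.
- have -> : 2 * d.+1 + 1 = 2 * d + 1 + 2 by lia.
  apply: reach_trans r1 _; run i0; run i1.
  rewrite size_cat addnA !addnS addn0; exact: reach_refl.
- have p1 : p != 1 by lia.
  by rewrite !updE upd_neq // (f1 p) // v1; lia.
- by move=> x hx; rewrite !upd_neq // f1.
Qed.

Lemma double_P_correct q s :
  env (eval (iter q (CSeq double_P) double_P) s) vP = 2 ^ q.+1 * env s vP.
Proof.
have dbl s' : env (eval double_P s') vP = 2 * env s' vP.
  by rewrite /double_P eval_asn /= updE addnn mul2n.
elim: q s => [|q IH] s; first exact: dbl.
by rewrite iterS eval_seq IH dbl mulnA -expnSr.
Qed.

Lemma init_prog_correct s : let s' := eval init_prog s in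
  env s' vQ = env s vn * env s vn + (env s vn + 3) /\ env s' vP = 2 ^ (9 * env s vk).
Proof.
rewrite /init_prog !eval_seq.
set s1 := eval (CAsn vQ _) s; set s2 := eval _ s1.
have k2 : env s2 vk = env s vk by [].
split.
  rewrite eval_modv // -[LHS]/(env s1 vQ) /s1 eval_asn /= updE.
  by rewrite sum_nat_const card_ord.
rewrite -k2; apply: (@for_ind vj vk _ s2 (fun j s' => env s' vP = 2 ^ (9 * j))).
- by [].
- by [].
- by move=> j s' _ _ _ e; rewrite double_P_correct e -expnD; congr (2 ^ _); lia.
Qed.

Lemma copy_cell_arr t s t' p : arr (eval (copy_cell t) s) t' p =
  if (t' == 0) && (p == env s vQ + (nr + (4 * env s vu + t))) then arr s t (env s vu)
  else arr s t' p.
Proof.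
rewrite /copy_cell eval_st !ev_EAdd !ev_EV ev_EK /=.
case: eqP => [->|//] /=; rewrite /upd.
suff -> : env s vQ + (nr + t) + (env s vu + env s vu + (env s vu + env s vu)) =
  env s vQ + (nr + (4 * env s vu + t)) by [].
lia.
Qed.

Lemma clear_cell_arr t s t' p : arr (eval (clear_cell t) s) t' p =
  if (t' == t) && (p == env s vu) then 0 else arr s t' p.
Proof. by rewrite /clear_cell eval_st /=; case: eqP => [->|]. Qed.

Lemma copy_cell_env t s : env (eval (copy_cell t) s) = env s.
Proof. by []. Qed.

Lemma clear_cell_env t s : env (eval (clear_cell t) s) = env s.
Proof. by []. Qed.

Lemma copy_body_arr s t p : arr (eval copy_body s) t p =
  let base := env s vQ + (nr + 4 * env s vu) in
  if t == 0 then
    if base <= p < base + 4 then arr s (p - base) (env s vu) else arr s 0 p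
  else if (t < 4) && (p == env s vu) then 0 else arr s t p.
Proof.
rewrite !eval_seq !(clear_cell_arr, copy_cell_arr, clear_cell_env, copy_cell_env) /=.
set Q := env s vQ; set u := env s vu.
case: t => [|[|[|[|t]]]] //=; rewrite ?andbF //=.
have [hp|hp] := leqP (Q + (nr + 4 * u)) p; last first.
  by do ?(case: eqP => [?|_]; first lia).
have E c : (p == Q + (nr + (4 * u + c))) = (p - (Q + (nr + 4 * u)) == c) by lia.
have -> : (p < Q + (nr + 4 * u) + 4) = (p - (Q + (nr + 4 * u)) < 4) by lia.
by rewrite !E; move: (p - _) => [|[|[|[|d]]]].
Qed.

Lemma copy_prog_correct s : let Q := env s vQ in let s' := eval copy_prog s in
  [/\ forall a t, a < Q -> t < 4 -> arr s' 0 (Q + (nr + (4 * a + t))) = arr s t a,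
      forall a t, 0 < t < 4 -> arr s' t a = if a < Q then 0 else arr s t a
    & forall p, p < Q + nr -> arr s' 0 p = arr s 0 p].
Proof.
move=> Q.
pose I j s' := [/\ forall a t, a < j -> t < 4 ->
        arr s' 0 (Q + (nr + (4 * a + t))) = arr s t a,
      forall a t, 0 < t < 4 -> arr s' t a = if a < j then 0 else arr s t a
    & forall p, p < Q + nr -> arr s' 0 p = arr s 0 p].
suff : I Q (eval copy_prog s) by [].
apply: for_ind => //.
move=> j s1 hj fr ej [I1 I2 I3].
have Q1 : env s1 vQ = Q by apply: fr.1.
set s2 := eval _ s1.
have arr1 t p := copy_body_arr s1 t p; rewrite -/s2 Q1 ej in arr1.
split.
- move=> a t aj ht; rewrite arr1 /=.
  case: ifP => h; last by apply: I1 => //; lia.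
  have -> : Q + (nr + (4 * a + t)) - (Q + (nr + 4 * j)) = t by lia.
  have -> : a = j by lia.
  (* Cell [j] of array 0 lies below [Q], where nothing is ever overwritten; in the other arrays it
     has not been cleared yet. *)
  have [->|t0] := posnP t; first by apply: I3; lia.
  by rewrite I2 ?t0 // ltnn.
- move=> a t /andP[t0 t4]; rewrite arr1 /= t4 eqn0Ngt t0 /= ltnS leq_eqVlt.
  by case: eqP => //= _; apply: I2; rewrite t0.
- by move=> p hp; rewrite arr1 /= I3 //; case: ifP => //; lia.
Qed.

Lemma unpack_correct d s m : (forall q, m (3 + q) <= 1) ->
  env s vpk = packed m 3 d -> let Q := env s vQ in let s' := eval (unpack_prog d) s in
  [/\ forall q, q < d -> (arr s' 0 (Q + (3 + q)) != 0) = (m (3 + q) != 0),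
      forall p, Q + (3 + d) <= p -> arr s' 0 p = arr s 0 p
    & forall t, t != 0 -> arr s' t = arr s t].
Proof.
move=> hm; elim: d s => [|d IH] s hs Q; first by split.
rewrite /= eval_seq eval_seq.
set test := ESub _ _; set s1 := eval (CSt _ _ _) s; set s2 := eval (CIf _ _) s1.
have lt := packed_lt d hm.
have testE s' : env s' vpk = env s vpk -> ev test s' = packed m 3 d.+1 + 1 - 2 ^ d.
  by rewrite -hs /= => ->.
have ms : (packed m 3 d.+1 + 1 - 2 ^ d != 0) = (m (3 + d) != 0).
  rewrite packedSr; case: (m (3 + d)) (hm d) => [|[|]] // _; lia.
have s2E : s2 = if m (3 + d) != 0 then setv s1 vpk (packed m 3 d.+1 - 2 ^ d) else s1.
  by rewrite /s2 eval_if testE // ms eval_asn ev_ESub ev_EV ev_EK -hs.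
have arr2 : arr s2 = arr s1 by rewrite s2E; case: ifP.
have Q2 : env s2 vQ = Q by rewrite s2E; case: ifP.
have pk2 : env s2 vpk = packed m 3 d.
  rewrite s2E; case: (m (3 + d)) (hm d) (packedSr m 3 d) => [|[|b]] // _ e.
  - by rewrite -[LHS]/(env s vpk) hs e; lia.
  - by rewrite -[LHS]/(packed m 3 d.+1 - 2 ^ d) e; lia.
have arr0 p : arr s1 0 p = if p == Q + (3 + d) then packed m 3 d.+1 + 1 - 2 ^ d else arr s 0 p.
  by rewrite /s1 eval_st testE.
have [h1 h2 h3] := IH s2 pk2; rewrite Q2 in h1 h2.
split.
- move=> q; rewrite ltnS leq_eqVlt => /orP[/eqP->|]; last exact: h1.
  by rewrite h2 // arr2 arr0 eqxx ms.
- move=> p hp; rewrite h2; last lia.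
  by rewrite arr2 arr0; case: eqP => // ?; lia.
- by move=> t ht; rewrite h3 // arr2 /s1 eval_st /= (negbTE ht).
Qed.

Lemma nth_allpairs (T : Type) (x0 : T) (g : T -> T -> nat) s1 s2 a b :
  a < size s1 -> b < size s2 ->
  nth 0 [seq g x y | x <- s1, y <- s2] (a * size s2 + b) = g (nth x0 s1 a) (nth x0 s2 b).
Proof.
elim: s1 a => [|x s1 IH] [|a] //= ha hb; rewrite nth_cat size_map.
  by rewrite hb (nth_map x0).
rewrite mulSn -addnA ltnNge leq_addr /= addKn; exact: IH.
Qed.

Section Encode.
Variables (n : nat) (G : rel 'I_n) (R : {set 'I_n}) (t k : nat).

Lemma encode_R (i : 'I_n) : encode G R t k (3 + i) = (i \in R).
Proof.
rewrite /encode /= nth_cat size_map size_enum_ord ltn_ord add0n.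
by rewrite (nth_map i) ?size_enum_ord // nth_ord_enum.
Qed.

Lemma encode_G (i j : 'I_n) : encode G R t k (3 + n + (i * n + j)) = G i j.
Proof.
rewrite /encode -addnA /= add0n nth_cat size_map size_enum_ord ltnNge leq_addr /= addKn.
have := @nth_allpairs _ i (fun x y => G x y : nat) (enum 'I_n) (enum 'I_n) i j.
by rewrite !size_enum_ord !nth_ord_enum; apply.
Qed.

Lemma encode_default p : 3 + n + n * n <= p -> encode G R t k p = 0.
Proof.
move=> hp; rewrite /encode nth_default //= size_cat size_map size_allpairs !size_enum_ord.
lia.
Qed.

Lemma encode_le1 q : encode G R t k (3 + q) <= 1.
Proof.
rewrite /encode /=; set l := _ ++ _.
have : all (fun x => x <= 1) l.
  rewrite all_cat; apply/andP; split; first by apply/allP => _ /mapP[x _ ->]; case: (_ \in _).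
  by apply/allP => _ /allpairsP[[x y] /= [_ _ ->]]; case: (G x y).
by move=> /(all_nthP 0) h; case: (ltnP q (size l)) => [/h//|hq]; rewrite nth_default.
Qed.

End Encode.

Lemma modv_unpack q x : x \in modv (unpack_prog q) -> x \in [:: vpk; vt].
Proof.
elim: q => [|q IH] /=; rewrite !inE; first by move=> ->; rewrite orbT.
by case/orP=> [->//|/IH]; rewrite !inE.
Qed.

Lemma wfc_unpack B q : ~~ B vpk -> ~~ B vt -> wfc B (unpack_prog q).
Proof. by move=> h1 h2; elim: q => [|q IH] /=; rewrite ?h1 ?h2. Qed.

(** * The complete program and its running time *)

Definition main_prog :=
  CSeq copy_prog (CSeq (unpack_prog (nr - 3))
    (CSeq closure_prog (CSeq rows_prog (CSeq join_prog answer_prog)))).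

(** [vn] is register 0, where the verdict is expected. It bounds loops of [main_prog], so the answer
    is moved there only afterwards. *)
Definition out_prog := CAsn vn (EV vt).

Definition steiner_program : program :=
  let boot := pack_code 3 (nr - 3) in
  boot ++ ccomp init_prog (size boot)
    ++ ccomp main_prog (size boot + csize init_prog)
    ++ ccomp out_prog (size boot + csize init_prog + csize main_prog).

Section Main.
Variables (K : realType) (n : nat) (G : rel 'I_n) (R : {set 'I_n}) (t k : nat).
Hypotheses (Gsimple : simple_graph G) (Gdisk : unit_disk_graph K G) (k_gt0 : 0 < k).

Lemma attained_small (S : {set 'I_n}) v c c' :
  c <= c' -> attained G R S v c -> attained G R S v c'.
Proof. by move=> le [W [h1 h2 h3 h4]]; exists W; split=> //; apply: leq_trans le. Qed.

Lemma solver_correct s Q P : input_ok G R k Q P s -> P = 2 ^ (9 * k) ->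
  (forall u a, 0 < u < 4 -> arr s u a = 0) ->
  env (eval (CSeq closure_prog (CSeq rows_prog (CSeq join_prog answer_prog))) s) vt != 0
  <-> steiner_yes G R k.
Proof.
move=> ok0 P_def a0; rewrite 3!eval_seq.
have row0 u X : 0 < u < 4 -> row n s u X = set0.
  by move=> hu; apply/setP => i; rewrite !inE a0 ?eqxx.
have clos := closure_prog_correct ok0 (fun u => row0 1 u isT).
have ok1 := input_ok_frame (frame_eval closure_prog s) isT isT ok0.
have z1 u a : 1 < u < 4 -> arr (eval closure_prog s) u a = 0.
  move=> hu; rewrite eval_moda ?a0 //; first by lia.
  by rewrite !inE; lia.
move: (eval closure_prog s) clos ok1 z1 => s1 clos ok1 z1.
have row1 X : row n s1 2 X = set0 by apply/setP => i; rewrite !inE z1.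
have rinv := rows_prog_correct Gsimple P_def ok1 row1 clos.
have ok2 := input_ok_frame (frame_eval rows_prog s1) isT isT ok1.
have z2 a : arr (eval rows_prog s1) 3 a = 0 by rewrite eval_moda ?z1.
have clos2 u : row n (eval rows_prog s1) 1 u = row n s1 1 u by rewrite /row eval_moda.
have {clos2} clos2 (u : 'I_n) : row n (eval rows_prog s1) 1 u = component G R u.
  by rewrite clos2 clos.
move: (eval rows_prog s1) rinv ok2 z2 clos2 => s2 [I [sepI [eN NP] last_row rows done]] ok2 z2 clos2.
have ok3 := input_ok_frame (frame_eval join_prog s2) isT isT ok2.
apply: (iff_trans (answer_prog_correct ok3)); rewrite !(@eval_modv join_prog) // eN.
apply: (iff_trans _ (iff_sym (steiner_attained Gsimple R k))).
case: ifP done => [/eqP-> done|bad [I' sepI' cI']]; last first.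
  split=> [[e _]|[v [W [cW vW RW cR]]]]; first by rewrite e in bad.
  (* Since [k] is positive, more than [9 * k] components are at least two, as the packing bound
     demands. *)
  have I2 : 1 < #|I'| by lia.
  by have := separated_packing Gsimple Gdisk cW RW sepI' I2; lia.
have hullI : hull G R I = R.
  apply/eqP; rewrite eqEsubset hull_sub; apply/subsetP => i iR; exact: done.
(* Every component has a representative in [I], so the hull of [W] is already the hull of the
   representatives that lie in it. *)
have hrows : hull_rows G R P s2.
  move=> W; have [X XN eX] := rows (I :&: hull G R W) (subsetIl _ _).
  exists X; first exact: leq_trans NP.
  rewrite eX; apply/setP => x; apply/bigcupP/bigcupP => -[i].
    move=> /setIP[iI /bigcupP[w wW iw]] xi; exists w => //; exact: component_trans iw xi.
  move=> iW xi; have : i \in hull G R I.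
    by rewrite hullI; move: xi; rewrite inE => /and3P[].
  case/bigcupP => j jI ij; exists j.
    rewrite inE jI; apply/bigcupP; exists i => //; by rewrite component_sym.
  by rewrite -(component_eq Gsimple ij).
have [sound complete] := join_prog_correct Gsimple P_def ok2 z2 clos2 hrows.
have Npos : 0 < 2 ^ #|I| by rewrite expn_gt0.
(* Row [2 ^ #|I| - 1] is all of [R], and a positive entry in it means a cost of at most [k]. *)
split=> [[_ [v hv]]|[v [W [cW vW RW cR]]]].
  have [|_] := sound (2 ^ #|I| - 1) v; first by rewrite lt0n.
  rewrite last_row hullI => at1; exists v; apply: attained_small at1.
  by move: hv; case: (arr _ _ _) => // g _; rewrite subSS leq_subr.
split=> //; exists v; rewrite -lt0n.
have ZP : 2 ^ #|I| - 1 < P by lia.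
have := complete W v (connected_rooted Gsimple cW vW) _ ZP.
rewrite last_row hullI sub_hull // => /(_ isT); apply: leq_trans.
by rewrite subn_gt0 ltnS.
Qed.

Lemma main_prog_correct s : let m := encode G R t k in
  env s vn = n -> env s vk = k -> env s vQ = n * n + (n + 3) ->
  env s vP = 2 ^ (9 * k) -> env s vpk = packed m 3 (nr - 3) ->
  (forall u a, u < 4 -> arr s u a = m (nr + 4 * a + u)) ->
  env (eval main_prog s) vt != 0 <-> steiner_yes G R k.
Proof.
move=> m en ek eQ eP epk arr0; rewrite /main_prog eval_seq.
set Q := n * n + (n + 3) in eQ.
have [] := copy_prog_correct s; rewrite eQ.
have fr x : x != vu -> env (eval copy_prog s) x = env s x.
  by move=> hx; apply: eval_modv; rewrite !inE.
move: (eval copy_prog s) fr => s1 fr c1 c2 c3.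
rewrite eval_seq.
have pk1 : env s1 vpk = packed m 3 (nr - 3) by rewrite fr.
have [] := unpack_correct (encode_le1 G R t k) pk1.
have fr2 x : x \notin [:: vpk; vt] -> env (eval (unpack_prog (nr - 3)) s1) x = env s1 x.
  move=> hx; apply: eval_modv; apply: contra hx; exact: modv_unpack.
move: (eval (unpack_prog (nr - 3)) s1) fr2 => s2 fr2.
rewrite fr // eQ => u1 u2 u3.
(* Positions below [nr] come from the packed bits, the others from the copied arrays. *)
have input p : 3 <= p < 3 + n + n * n -> (arr s2 0 (Q + p) != 0) = (m p != 0).
  case/andP=> p3 hp; have [hpn|hpn] := ltnP p nr.
    rewrite -(subnKC p3) u1 //; lia.
  rewrite u2; last by unfold nr in *; lia.
  have [a [u [ep hu]]] : exists a u, p = nr + (4 * a + u) /\ u < 4.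
    by exists ((p - nr) %/ 4), ((p - nr) %% 4); rewrite ltn_mod mulnC -divn_eq subnKC.
  have aQ : a < Q by rewrite /Q; lia.
  by rewrite ep c1 // arr0 // addnA.
apply: (@solver_correct s2 Q (2 ^ (9 * k))) => //.
  split; rewrite ?fr2 ?fr //.
  - move=> i; rewrite input /m ?encode_R ?eqb0 ?negbK //.
    by have := ltn_ord i; lia.
  - move=> i j; rewrite input /m ?encode_G ?eqb0 ?negbK //.
    have := ltn_ord i; have := ltn_ord j; nia.
move=> u a hu; rewrite u3; last lia.
(* Cells from [Q] on were not cleared, but they lie beyond the end of the input. *)
rewrite c2 //; case: ltnP => // aQ; rewrite arr0; last lia.
by apply: encode_default; rewrite /Q in aQ; unfold nr; lia.
Qed.

End Main.

Definition loop_bounds_init : pred nat := [pred r | r \in [:: vn; vk]].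
Definition loop_bounds_main : pred nat := [pred r | r \in [:: vn; vk; vQ; vP]].

Lemma steiner_program_correct (K : realType) n (G : rel 'I_n) (R : {set 'I_n}) t k M :
  simple_graph G -> unit_disk_graph K G -> 0 < k ->
  n <= M -> k <= M -> n * n + (n + 3) <= M -> 2 ^ (9 * k) <= M ->
  decides_within steiner_program (encode G R t k)
    (2 * (nr - 3) + 1 + (ctime init_prog M + (ctime main_prog M + ctime out_prog M)))
    (steiner_yes G R k).
Proof.
move=> sG uG k0 nM kM QM PM.
set m := encode G R t k; set boot := pack_code 3 (nr - 3).
have full : code_at steiner_program 0 steiner_program by [].
have [c0 /code_at_cat[c1 /code_at_cat[c2 c3]]] := code_at_cat full.
rewrite add0n !size_ccomp in c1 c2 c3.
have [m1 [r1 v1 f1]] := @pack_correct steiner_program 3 (nr - 3) 0 m isT c0.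
pose s0 := State m1 (fun u a => m1 (nr + 4 * a + u)).
have ag0 : agree s0 m1 by [].
have b0 : bounded loop_bounds_init M s0.
  by move=> r; rewrite /loop_bounds_init /= !inE => /orP[] /eqP -> /=; rewrite f1.
have [m2 [r2 ag2 _]] := ccomp_correct (B := loop_bounds_init) (c := init_prog) isT c1 ag0 b0.
have [eQ eP] := init_prog_correct s0.
have e0 x : x \notin modv init_prog -> env (eval init_prog s0) x = m1 x.
  by move=> hx; rewrite eval_modv.
have ea u a : arr (eval init_prog s0) u a = m (nr + 4 * a + u).
  by rewrite eval_moda //= f1.
move: (eval init_prog s0) ag2 eQ eP e0 ea => s2 ag2 eQ eP e0 ea.
rewrite /= !f1 // in eQ eP.
have b2 : bounded loop_bounds_main M s2.
  by move=> r; rewrite /loop_bounds_main /= !inE => /or4P[] /eqP ->; rewrite ?eQ ?eP ?e0 ?f1.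
have wm : wfc loop_bounds_main main_prog.
  rewrite /main_prog -[wfc _ _]/(wfc loop_bounds_main copy_prog &&
    (wfc loop_bounds_main (unpack_prog (nr - 3)) && wfc loop_bounds_main
      (CSeq closure_prog (CSeq rows_prog (CSeq join_prog answer_prog))))).
  by rewrite wfc_unpack.
have [m3 [r3 ag3 _]] := ccomp_correct wm c2 ag2 b2.
have correct := @main_prog_correct K n G R t k sG uG k0 s2 _ _ eQ eP _ (fun u a _ => ea u a).
have b3 : bounded pred0 M (eval main_prog s2) by [].
have [m4 [r4 ag4 _]] := ccomp_correct (B := pred0) (c := out_prog) isT c3 ag3 b3.
have [T hT eT] := reach_trans r1 (reach_trans r2 (reach_trans r3 r4)).
exists T => //; rewrite eT; split.
  have size4 (a b c d : seq instr) :
    size (a ++ b ++ c ++ d) = 0 + size a + size b + size c + size d.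
    by rewrite !size_cat !addnA add0n.
  by rewrite /halted /steiner_program size4 !size_ccomp; apply: leqnn.
change (m4 0 != 0 <-> steiner_yes G R k).
have out s' : env (eval out_prog s') vn = env s' vt by [].
rewrite (ag4.1 0 isT) out.
by apply: correct; [rewrite e0 // f1|rewrite e0 // f1|rewrite e0 // v1].
Qed.

Theorem theorem2 :
  exists (P : program) (C c d : nat),
  forall (K : realType) (n : nat) (G : rel 'I_n) (R : {set 'I_n}) (t k : nat),
    simple_graph G -> unit_disk_graph K G -> #|R| = t -> 0 < k ->
    decides_within P (encode G R t k) (C * 2 ^ (c * k) * n.+1 ^ d)
      (steiner_yes G R k).
Proof.
have [A [D hAD]] : poly_bounded (fun M =>
    2 * (nr - 3) + 1 + (ctime init_prog M + (ctime main_prog M + ctime out_prog M))).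
  by repeat (first [exact: poly_bounded_const | exact: poly_bounded_ctime
    | apply: poly_bounded_add]).
exists steiner_program, (A * 4 ^ D), (9 * D), (2 * D) => K n G R t k sG uG _ k0.
(* [M] dominates every loop bound: [n], [k], [2 ^ (9 * k)] and [n * n + n + 3], which is at most
   [3 * n.+1 ^ 2]. Passing from [M] to [M.+1] turns the factor 3 into 4, the source of [4 ^ D]. *)
pose M := 3 * n.+1 ^ 2 * 2 ^ (9 * k).
have kk : k < 2 ^ (9 * k).
  by apply: leq_trans (ltn_expl k (isT : 1 < 2)) _; rewrite leq_exp2l //; lia.
have [||||T hT h] := @steiner_program_correct K n G R t k M sG uG k0.
- rewrite /M; nia.
- rewrite /M; nia.
- rewrite /M; nia.
- rewrite /M; nia.
exists T => //; apply: leq_trans hT (leq_trans (hAD M) _).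
have -> : A * 4 ^ D * 2 ^ (9 * D * k) * n.+1 ^ (2 * D) =
    A * (4 * n.+1 ^ 2 * 2 ^ (9 * k)) ^ D.
  rewrite (mulnAC 9 D k) (expnM 2 (9 * k) D) (expnM n.+1 2 D).
  by rewrite [4 * _ * _]mulnAC !expnMn !mulnA.
rewrite leq_mul2l; apply/orP; right; case: (D) => [|D'] //; rewrite leq_exp2r //.
rewrite /M; have : 0 < n.+1 ^ 2 * 2 ^ (9 * k) by rewrite muln_gt0 !expn_gt0.
by rewrite -!mulnA; lia.
Qed.
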